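(* Let $f:2^\Omega\to\mathbb{R}_{\ge0}$ be a monotone submodular set function on a finite ground set $\Omega$ with $|\Omega|=d$ and $\sup_{X\subseteq\Omega}|f(X)|\le M$, and let $(\Omega,\mathcal{I})$ be a matroid. There is a universal constant $c$ such that, if the algorithm Discrete Black-Box Greedy described in the context is run for $T$ iterations with radius $\delta>0$, batch size $B_t$, $\rho_t=2/(t+3)^{2/3}$ and $S_{t,i}=l$, then its output $X_{T+1}$ satisfies $$(1-1/e)f(X^* )-\mathbb{E}[f(X_{T+1})]\le\frac{3D_1Q^{1/2}}{T^{1/3}}+\frac{2M\sqrt{d(d-1)}D_1^2}{T}+2M\delta\sqrt d\big(1+(\sqrt d+1)(1-1/e)\big),$$ where $D_1=\mathrm{diam}(\mathcal{K}')$ with $\mathcal{K}'$ defined in the context, $Q=\max\left\{\frac{2d^2M^2\left(\frac{1}{l\delta^2}+8c\right)}{B_t}+96d(d-1)M^2D_1^2,\ 4^{5/3}dM^2\right\}$, and $X^*$ is the global maximizer of $f$ under the matroid constraint $\mathcal{I}$.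
   Context: A set function $f$ is submodular if $f(A\cup\{x\})-f(A)\ge f(B\cup\{x\})-f(B)$ for all $A\subseteq B\subseteq\Omega$, $x\in\Omega\setminus B$, and monotone if $f(A)\le f(B)$ for $A\subseteq B$. Its multilinear extension is $F(x)=\sum_{S\subseteq\Omega}f(S)\prod_{i\in S}x_i\prod_{j\notin S}(1-x_j)=\mathbb{E}_{S\sim x}[f(S)]$, $x\in[0,1]^d$, where $S\sim x$ means each $i\in\Omega$ is included in $S$ independently with probability $x_i$. The matroid polytope is $\mathcal{K}=\mathrm{conv}\{1_I:I\in\mathcal{I}\}$. $\mathbf{1}$ is the all-ones vector; diameters are Euclidean. With $\mathcal{X}_\delta=[0,1-2\delta]^d$, the transformed constraint set is $\mathcal{K}'=\mathcal{X}_\delta\cap(\mathcal{K}-\delta\mathbf{1})$ (assumed nonempty, so that the algorithm is well defined). Discrete Black-Box Greedy: set $x_1=\mathbf{0}$, $\bar g_0=\mathbf{0}$. For $t=1,\dots,T$: sample $u_{t,1},\dots,u_{t,B_t}$ i.i.d. uniformly from the unit sphere $S^{d-1}$; for each $i$ let $y_{t,i}^{\pm}=\delta\mathbf{1}+x_t\pm\delta u_{t,i}$, independently sample subsets $Y_{t,i,j}^{\pm}\sim y_{t,i}^{\pm}$ for $j=1,\dots,S_{t,i}$, and set $\bar f_{t,i}^{\pm}=\frac{1}{S_{t,i}}\sum_{j=1}^{S_{t,i}}f(Y_{t,i,j}^{\pm})$; set $g_t=\frac{1}{B_t}\sum_{i=1}^{B_t}\frac{d}{2\delta}(\bar f_{t,i}^+-\bar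 f_{t,i}^-)u_{t,i}$; $\bar g_t=(1-\rho_t)\bar g_{t-1}+\rho_tg_t$; $v_t\in\arg\max_{v\in\mathcal{K}'}\langle v,\bar g_t\rangle$; $x_{t+1}=x_t+v_t/T$. Output $X_{T+1}=\mathrm{round}(x_{T+1}+\delta\mathbf{1})$, where $\mathrm{round}$ is a lossless rounding procedure: for $x\in\mathcal{K}$ it returns a (random) set $S\in\mathcal{I}$ with $\mathbb{E}[f(S)]\ge F(x)$. The batch size $B_t$ is the same for all $t$. *)

(* Defs.v *)
From HB Require Import structures.
From mathcomp Require Import all_boot all_order all_algebra.
From mathcomp Require Import all_classical all_reals all_analysis.

Set Implicit Arguments.
Unset Strict Implicit.
Unset Printing Implicit Defensive.

Import Order.TTheory GRing.Theory Num.Theory.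
Import numFieldNormedType.Exports.
Local Open Scope classical_set_scope.
Local Open Scope ring_scope.

Definition is_matroid (Omega : finType) (I : {set {set Omega}}) : Prop :=
  [/\ finset.set0 \in I,
      forall A B : {set Omega}, A \subset B -> B \in I -> A \in I
    & forall A B : {set Omega}, A \in I -> B \in I -> (#|A| < #|B|)%N ->
        exists x : Omega, [/\ x \in B, x \notin A & (x |: A)%SET \in I]].

Definition submodular (R : realType) (Omega : finType) (f : {set Omega} -> R)
    : Prop :=
  forall (A B : {set Omega}) (x : Omega), A \subset B -> x \notin B ->
    f (x |: A)%SET - f A >= f (x |: B)%SET - f B.

Definition monotone_set_fun (R : realType) (Omega : finType)
    (f : {set Omega} -> R) : Prop :=
  forall A B : {set Omega}, A \subset B -> f A <= f B.

Definition coordinate_cylinders (R : realType) (Omega : finType)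
    : set (set (Omega -> R)) :=
  [set A | exists (k : Omega) (B : set R),
     measurable B /\ A = [set x | B (x k)]].

(* The space R^Omega with its Borel sigma-algebra, which is generated by the
   coordinates because Omega is finite. *)
Notation vec R Omega := (g_sigma_algebraType (@coordinate_cylinders R Omega)).

Section Vectors.
Context {R : realType} {Omega : finType}.

Definition dotp (x y : Omega -> R) : R := \sum_k x k * y k.

Definition l2norm (x : Omega -> R) : R := Num.sqrt (dotp x x).

Definition diam (A : set (Omega -> R)) : R :=
  sup [set r | exists x y, [/\ A x, A y & r = l2norm (fun k => x k - y k)]].

Definition indicator (A : {set Omega}) : Omega -> R := fun k => (k \in A)%:R.

(* The probability of S ~ x. *)
Definition sample_prob (x : Omega -> R) (S : {set Omega}) : R :=
  (\prod_(i in S) x i) * \prod_(j in ~: S) (1 - x j).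

Definition multilinear_ext (f : {set Omega} -> R) (x : Omega -> R) : R :=
  \sum_(S : {set Omega}) f S * sample_prob x S.

Definition matroid_polytope (I : {set {set Omega}}) : set (Omega -> R) :=
  [set x | exists w : {set Omega} -> R,
     [/\ forall A, A \in I -> 0 <= w A,
         \sum_(A in I) w A = 1
       & forall k, x k = \sum_(A in I) w A * indicator A k]].

Definition transformed_set (I : {set {set Omega}}) (delta : R)
    : set (Omega -> R) :=
  [set x | forall k, 0 <= x k <= 1 - 2 * delta] `&`
  [set x | matroid_polytope I (fun k => x k + delta)].

Definition orthogonal_mx (q : Omega -> Omega -> R) : Prop :=
  forall i j, dotp (q i) (q j) = (i == j)%:R.

Definition mx_apply (q : Omega -> Omega -> R) (x : Omega -> R) : Omega -> R :=
  fun i => dotp (q i) x.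

(* The uniform distribution on the sphere, i.e. the (unique) Borel probability
   measure carried by the unit sphere that is invariant under the orthogonal
   group. *)
Definition uniform_sphere (mu : probability (vec R Omega) R) : Prop :=
  mu [set x | l2norm x = 1] = 1%E /\
  forall q, orthogonal_mx q ->
    forall A : set (vec R Omega), measurable A ->
      mu (mx_apply q @^-1` A) = mu A.

(* A randomized rounding is given by [rnd x A], the probability that it returns
   [A] on input [x]; it has to be a Markov kernel on the matroid polytope. *)
Record lossless_rounding (f : {set Omega} -> R) (I : {set {set Omega}})
    (rnd : (Omega -> R) -> {set Omega} -> R) : Prop := {
  rounding_ge0 : forall x A, matroid_polytope I x -> 0 <= rnd x A;
  rounding_sum1 : forall x, matroid_polytope I x -> \sum_A rnd x A = 1;
  rounding_indep : forall x A,
    matroid_polytope I x -> A \notin I -> rnd x A = 0;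
  rounding_lossless : forall x, matroid_polytope I x ->
    multilinear_ext f x <= \sum_A rnd x A * f A;
  rounding_measurable : forall (A : {set Omega}) (B : set R), measurable B ->
    measurable ((matroid_polytope I `&` [set x | B (rnd x A)])
                  : set (vec R Omega)) }.

Definition sample_mean (f : {set Omega} -> R) (n : nat)
    (Y : nat -> {set Omega}) : R :=
  n%:R^-1 * \sum_(j < n) f (Y j).

Definition gradient_estimate (delta : R) (b : nat) (fplus fminus : nat -> R)
    (u : nat -> Omega -> R) : Omega -> R :=
  fun k => b%:R^-1 *
    \sum_(i < b) #|Omega|%:R / (2 * delta) * (fplus i - fminus i) * u i k.

Definition is_argmax (K : set (Omega -> R)) (g v : Omega -> R) : Prop :=
  K v /\ forall z, K z -> dotp z g <= dotp v g.

End Vectors.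

Definition sub_sigma_algebra disp (T : measurableType disp)
    (F : set (set T)) : Prop :=
  sigma_algebra setT F /\ F `<=` measurable.

(* A run of Discrete Black-Box Greedy on a probability space, for N iterations
   numbered 1, ..., N, with parameters B t = B_t, S t i = S_{t,i} and
   rho t = rho_t. In the usual notation, u_{t,i} is [direction t i], x_t is
   [iterate t], y_{t,i} is [query t i], Y_{t,i,j} is [draw t i _ j], g_t is
   [gradient t], its running average is [momentum t], and v_t is [vertex t]; i
   and j are numbered from 0, and the signs + and - are [false] and [true].
   [hist t] is the information available at the end of iteration t, and
   [hist_dir t] the one available in iteration t once the directions u_{t,i}
   are drawn but before the sets Y_{t,i,j} are sampled. The filtration need
   not be generated by the run, which allows the ties in the argmax defining
   v_t to be broken arbitrarily, possibly at random, but without knowledge of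
   the future. *)
Record discrete_bbg (R : realType) (Omega : finType)
    disp (T : measurableType disp) (P : probability T R)
    (f : {set Omega} -> R) (I : {set {set Omega}})
    (rnd : (Omega -> R) -> {set Omega} -> R)
    (delta : R) (N : nat) (B : nat -> nat) (S : nat -> nat -> nat)
    (rho : nat -> R) := DiscreteBBG {
  hist : nat -> set (set T);
  hist_dir : nat -> set (set T);
  uniform_law : probability (vec R Omega) R;
  direction : nat -> nat -> T -> Omega -> R;
  draw : nat -> nat -> bool -> nat -> T -> {set Omega};
  iterate : nat -> T -> Omega -> R;
  momentum : nat -> T -> Omega -> R;
  vertex : nat -> T -> Omega -> R;
  output : T -> {set Omega};

  query := fun t i (s : bool) w k =>
    delta + iterate t w k + (-1) ^+ s * delta * direction t i w k;
  gradient := fun t w => gradient_estimate delta (B t)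
         (fun i => sample_mean f (S t i) (fun j => draw t i false j w))
         (fun i => sample_mean f (S t i) (fun j => draw t i true j w))
         (fun i => direction t i w);

  hist_sigma : forall t, sub_sigma_algebra (hist t);
  hist_dir_sigma : forall t, sub_sigma_algebra (hist_dir t);
  hist_incr : forall t, (1 <= t <= N)%N ->
    hist t.-1 `<=` hist_dir t /\ hist_dir t `<=` hist t;

  uniform_lawP : uniform_sphere uniform_law;
  (* u_{t,1}, ..., u_{t,B_t} are i.i.d. and independent of the past *)
  direction_adapted : forall t i, (1 <= t <= N)%N -> (i < B t)%N ->
    forall A : set (vec R Omega), measurable A ->
      hist_dir t (direction t i @^-1` A);
  direction_law : forall t, (1 <= t <= N)%N -> forall H, hist t.-1 H ->
    forall A : nat -> set (vec R Omega), (forall i, measurable (A i)) ->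
      P (H `&` [set w | forall i, (i < B t)%N -> A i (direction t i w)]) =
      (P H * \prod_(i < B t) uniform_law (A i))%E;

  (* given [hist_dir t], the sets are independent and distributed as S ~ y *)
  draw_adapted : forall t i s j,
    (1 <= t <= N)%N -> (i < B t)%N -> (j < S t i)%N -> forall A,
      hist t [set w | draw t i s j w = A];
  draw_law : forall t, (1 <= t <= N)%N -> forall H, hist_dir t H ->
    forall a : nat -> bool -> nat -> {set Omega},
      P (H `&` [set w | forall i s j, (i < B t)%N -> (j < S t i)%N ->
                          draw t i s j w = a i s j]) =
      (\int[P]_(w in H)
         (\prod_(i < B t) \prod_(s : bool) \prod_(j < S t i)
            sample_prob (query t i s w) (a i s j))%:E)%E;

  iterate_init : forall w k, iterate 1%N w k = 0;
  momentum_init : forall w k, momentum 0%N w k = 0;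
  momentum_step : forall t w k, (1 <= t <= N)%N ->
    momentum t w k = (1 - rho t) * momentum t.-1 w k + rho t * gradient t w k;
  vertex_adapted : forall t, (1 <= t <= N)%N ->
    forall A : set (vec R Omega), measurable A -> hist t (vertex t @^-1` A);
  vertex_argmax : forall t w, (1 <= t <= N)%N ->
    is_argmax (transformed_set I delta) (momentum t w) (vertex t w);
  iterate_step : forall t w k, (1 <= t <= N)%N ->
    iterate t.+1 w k = iterate t w k + vertex t w k / N%:R;

  (* given the whole run, the output is distributed as round(x_{N+1} + delta) *)
  output_measurable : forall A, measurable [set w | output w = A];
  output_law : forall H, hist N H -> forall A,
    P (H `&` [set w | output w = A]) =
    (\int[P]_(w in H) (rnd (fun k => iterate N.+1 w k + delta) A)%:E)%E }.

(* Main.v *)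
Require Import Defs.
From HB Require Import structures.
From mathcomp Require Import all_boot all_order all_algebra.
From mathcomp Require Import all_classical all_reals all_analysis.
From mathcomp Require Import perm measurable_realfun ring lra.
Import Order.TTheory GRing.Theory Num.Theory.
Import numFieldNormedType.Exports.
Local Open Scope classical_set_scope.
Local Open Scope ring_scope.

(** The multilinear extension [F] of [f] is affine in each coordinate, and this
    makes the smoothing in the algorithm exact.  Expand
    [F (y + delta u) = \sum_A coef A * delta^|A| * \prod_(i in A) u_i].  The
    uniform law on the sphere is invariant under sign flips of coordinates, so
    distinct monomials are orthogonal, and permuting coordinates gives
    [E u_k^2 = 1 / d].  Hence
    [E (d / (2 delta)) (F (y + delta u) - F (y - delta u)) u_k] is the partial
    derivative of [F] in [k] at [y] itself: the two-point estimate has no bias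
    ([mean_diff_unbiased]).

    Its second moment involves only the odd monomials.  For a fixed [u], Parseval
    over the [2^d] sign patterns bounds the energy of these monomials by the sum
    of the influences of the coordinates, that is by [M^2 delta^2], because
    partial derivatives of a monotone [F] with values in [[0, M]] lie in [[0, M]]
    on the cube ([odd_energy_bound]).  So the exact finite difference contributes
    [d^2 M^2] and the sampling of the sets [d^2 M^2 / (2 l delta^2)]; directions
    and samples of distinct indices are uncorrelated, and averaging [b] of them
    divides the variance by [b] ([grad_est_variance]).  This is
    within the stated bound for [c = 1].

    The averaged gradient then follows the true one: old error and fresh noise are
    orthogonal, the drift of the gradient is controlled by its Lipschitz constant
    [M sqrt (d (d - 1))], and the recursion with weights [2 / (t + 3)^(2/3)] keeps
    the mean squared error of iteration [t] below [Q / (t + 4)^(2/3)]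
    ([momentum_error]).

    For the greedy part, write [delta * 1], a point of the polytope since the
    latter is closed downwards, as a convex combination of independent sets.  The
    empty set carries weight at least [1 - delta d]; moving this weight to [Xstar]
    shows that [s * 1_Xstar] is feasible for some [s >= 1 - 2 delta d]
    ([scaled_indicator_transformed]).  As
    [\sum_(k in Xstar) dF/dx_k >= f Xstar - F] by submodularity, competing with this point
    in the linear maximization contracts the gap [s f Xstar - F] by [1 - 1 / N] per
    iteration, up to the gradient error and a second-order term ([greedy_step]).
    Unrolling gives the factor [1 - 1 / e]; replacing [s f Xstar] by [f Xstar] costs
    [2 delta d M]; the rounding loses nothing on average ([output_mean]). *)

Set Implicit Arguments.
Unset Strict Implicit.
Unset Printing Implicit Defensive.

(** * Bounded random variables and conditional means *)

Section BoundedRV.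
Context {R : realType} {d : measure_display} {T : measurableType d}.
Variable P : probability T R.
Implicit Types (G : set (set T)) (X Y Z : T -> R).

(** Measurability with respect to a family [G] of sets, encoded on the type [T]
    re-equipped with the sigma-algebra generated by [G], so that the closure
    properties of measurable functions apply. *)
Definition meas_wrt G X : Prop :=
  measurable_fun [set: g_sigma_algebraType G] (X : g_sigma_algebraType G -> R).

(** The bound holds almost surely only: the directions are known to lie on the
    sphere up to a null set. *)
Definition bddrv G X : Prop :=
  meas_wrt G X /\ exists C : R, {ae P, forall w, `|X w| <= C}.

Definition Ex X : R := \int[P]_w X w.

Local Notation full := (@measurable d T).

Lemma meas_wrt_full X : meas_wrt full X <-> measurable_fun [set: T] X.
Proof.
have E : @measurable _ (g_sigma_algebraType full) = full.
  apply: measurable_g_measurableTypeE; exact: sigma_algebra_measurable.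
split=> mX mT B mB; have := mX _ B mB.
- by rewrite E; apply.
- by rewrite E; apply.
Qed.

Lemma meas_wrt_sub G G' X : G `<=` G' -> meas_wrt G X -> meas_wrt G' X.
Proof.
move=> GG' mX mT B mB; apply: (sub_sigma_algebra2 GG').
exact: (mX measurableT B mB).
Qed.

Lemma bddrv_sub G G' X : G `<=` G' -> bddrv G X -> bddrv G' X.
Proof. by move=> GG' [mX bX]; split=> //; apply: meas_wrt_sub mX. Qed.

Lemma bddrv_cst G c : bddrv G (fun=> c).
Proof.
split; first exact: measurable_cst.
by exists `|c|; apply: aeW.
Qed.

Lemma bddrvD G X Y : bddrv G X -> bddrv G Y -> bddrv G (fun w => X w + Y w).
Proof.
move=> [mX [C bX]] [mY [D bY]]; split; first exact: measurable_funD.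
exists (C + D); apply: filterS2 bX bY => w hX hY.
by apply: le_trans (ler_normD _ _) _; apply: lerD.
Qed.

Lemma bddrvM G X Y : bddrv G X -> bddrv G Y -> bddrv G (fun w => X w * Y w).
Proof.
move=> [mX [C bX]] [mY [D bY]]; split; first exact: measurable_funM.
exists (C * D); apply: filterS2 bX bY => w hX hY.
by rewrite normrM; apply: ler_pM.
Qed.

Lemma bddrvN G X : bddrv G X -> bddrv G (fun w => - X w).
Proof.
move=> [mX [C bX]]; split; first exact: measurable_funN.
by exists C; apply: filterS bX => w; rewrite normrN.
Qed.

Lemma bddrvB G X Y : bddrv G X -> bddrv G Y -> bddrv G (fun w => X w - Y w).
Proof. by move=> bX bY; apply: bddrvD => //; apply: bddrvN. Qed.

Lemma bddrvZ G c X : bddrv G X -> bddrv G (fun w => c * X w).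
Proof. by move=> bX; apply: bddrvM => //; apply: bddrv_cst. Qed.

Lemma bddrv_sum G (J : Type) (r : seq J) (p : pred J) (X : J -> T -> R) :
  (forall j, p j -> bddrv G (X j)) -> bddrv G (fun w => \sum_(j <- r | p j) X j w).
Proof.
move=> bX; elim: r => [|j r IH].
  by under eq_fun do rewrite big_nil; exact: bddrv_cst.
under eq_fun do rewrite big_cons.
by case pj: (p j) => //; apply: bddrvD => //; apply: bX.
Qed.

Lemma bddrv_prod G (J : Type) (r : seq J) (p : pred J) (X : J -> T -> R) :
  (forall j, p j -> bddrv G (X j)) -> bddrv G (fun w => \prod_(j <- r | p j) X j w).
Proof.
move=> bX; elim: r => [|j r IH].
  by under eq_fun do rewrite big_nil; exact: bddrv_cst.
under eq_fun do rewrite big_cons.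
by case pj: (p j) => //; apply: bddrvM => //; apply: bX.
Qed.

Lemma bddrvX G X n : bddrv G X -> bddrv G (fun w => X w ^+ n).
Proof.
move=> bX; elim: n => [|n IH]; first exact: bddrv_cst.
by under eq_fun do rewrite exprS; apply: bddrvM.
Qed.

Lemma bddrv_indic G H : G H -> bddrv G (\1_H : T -> R).
Proof.
move=> GH; split.
  apply/measurable_indic; exact: sub_sigma_algebra.
exists 1; apply: aeW => w; rewrite indicE.
by case: (w \in H); rewrite ?normr1 ?normr0.
Qed.

Lemma bddrv_discrete (S : finType) G (Z : T -> S) (phi : S -> R) :
  (forall s, G [set w | Z w = s]) -> bddrv G (fun w => phi (Z w)).
Proof.
move=> GZ.
rewrite (_ : (fun w => _) = (fun w => \sum_s phi s * \1_[set w | Z w = s] w)).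
  by apply: bddrv_sum => s _; apply: bddrvZ; exact: bddrv_indic.
apply/funext => w; rewrite (bigD1 (Z w))//= indicE mem_set// mulr1.
rewrite big1 ?addr0// => s sZ; rewrite indicE memNset ?mulr0//= => /esym/eqP.
exact/negP.
Qed.

Lemma bddrv_integrable X : bddrv full X -> P.-integrable setT (EFin \o X).
Proof.
move=> [/meas_wrt_full mX [C bX]]; apply/integrableP; split.
  exact/measurable_EFinP.
apply: (@le_lt_trans _ _ (\int[P]_(x in setT) (`|C|)%:E)%E).
  apply: ae_ge0_le_integral => //.
  - by do 2 apply: measurableT_comp => //.
  - apply: filterS bX => w hw _.
    by rewrite lee_fin; apply: le_trans hw _; rewrite ler_norm.
by rewrite integral_cst// [X in (_ * X)%E](probability_setT P) mule1 ltry.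
Qed.

Lemma Ex_cst c : Ex (fun=> c) = c.
Proof. by rewrite /Ex Rintegral_cst// [X in fine X](probability_setT P) mulr1. Qed.

Lemma ExD X Y : bddrv full X -> bddrv full Y ->
  Ex (fun w => X w + Y w) = Ex X + Ex Y.
Proof. by move=> bX bY; rewrite /Ex RintegralD//; exact: bddrv_integrable. Qed.

Lemma ExB X Y : bddrv full X -> bddrv full Y ->
  Ex (fun w => X w - Y w) = Ex X - Ex Y.
Proof. by move=> bX bY; rewrite /Ex RintegralB//; exact: bddrv_integrable. Qed.

Lemma ExZ c X : bddrv full X -> Ex (fun w => c * X w) = c * Ex X.
Proof. by move=> bX; rewrite /Ex RintegralZl//; exact: bddrv_integrable. Qed.

Lemma Ex_sum (J : Type) (r : seq J) (p : pred J) (X : J -> T -> R) :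
  (forall j, p j -> bddrv full (X j)) ->
  Ex (fun w => \sum_(j <- r | p j) X j w) = \sum_(j <- r | p j) Ex (X j).
Proof.
move=> bX; elim: r => [|j r IH].
  by under eq_fun do rewrite big_nil; rewrite big_nil Ex_cst.
under eq_fun do rewrite big_cons.
rewrite big_cons; case pj: (p j) => //.
by rewrite ExD ?IH//; [exact: bX | exact: bddrv_sum].
Qed.

Lemma Ex_ae X Y : bddrv full X -> bddrv full Y ->
  {ae P, forall w, X w = Y w} -> Ex X = Ex Y.
Proof.
move=> [/meas_wrt_full mX _] [/meas_wrt_full mY _] XY.
congr fine; apply: ae_eq_integral => //; try exact/measurable_EFinP.
by apply: filterS XY => w /= -> .
Qed.

Lemma Ex_le X Y : bddrv full X -> bddrv full Y ->
  {ae P, forall w, X w <= Y w} -> Ex X <= Ex Y.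
Proof.
move=> bX bY XY; rewrite -subr_ge0 -ExB//.
have mB := bddrvB bY bX.
have mM : bddrv full (fun w => Num.max (Y w - X w) 0).
  case: mB => mB [C bB]; split.
    by apply: measurable_maxr => //; exact: measurable_cst.
  exists C; apply: filterS bB => w; apply: le_trans.
  by rewrite maxEle; case: ifP => // _; rewrite normr0.
rewrite (Ex_ae mB mM).
  by apply: Rintegral_ge0 => w _; rewrite le_max lexx orbT.
by apply: filterS XY => w XY; rewrite max_l// subr_ge0.
Qed.

Lemma Ex_indic H : measurable H -> Ex (\1_H) = fine (P H).
Proof.
by move=> mH; rewrite /Ex /Rintegral integral_indic// setIT.
Qed.

Lemma Ex_indicM H X : Ex (fun w => \1_H w * X w) = \int[P]_(w in H) X w.
Proof.
rewrite /Ex [RHS]Rintegral_mkcond; congr (Rintegral _ _ _); apply/funext => w.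
by rewrite patchE indicE; case: ifP; rewrite ?mul1r ?mul0r.
Qed.

(** Equality of the conditional means of [X] and [Y] given [G], phrased with
    bounded [G]-measurable factors so that both sides are plain means. *)
Definition condeq G X Y : Prop :=
  forall Z, bddrv G Z -> Ex (fun w => Z w * X w) = Ex (fun w => Z w * Y w).

(** It is enough to test against indicators of sets of [G]: a bounded factor [Z]
    is a uniform limit of its discretizations to multiples of [1 / m]. *)
Lemma condeq_of_sets G X Y : Defs.sub_sigma_algebra G ->
  bddrv full X -> bddrv full Y ->
  (forall H, G H -> Ex (fun w => \1_H w * X w) = Ex (fun w => \1_H w * Y w)) ->
  condeq G X Y.
Proof.
move=> [sG Gm] bX bY XY Z bGZ.
have bZ : bddrv full Z by apply: bddrv_sub bGZ.
pose D w := X w - Y w.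
have bD : bddrv full D by exact: bddrvB.
have D0 H : G H -> Ex (fun w => \1_H w * D w) = 0.
  move=> GH; have bH : bddrv full (\1_H) by apply: bddrv_indic; apply: Gm.
  under [X in Ex X]eq_fun do rewrite /D mulrBr.
  by rewrite ExB ?XY ?subrr//; exact: bddrvM.
apply/eqP; rewrite -subr_eq0 -ExB; try exact: bddrvM.
under eq_fun do rewrite -mulrBr -/(D _).
have [C bC] := bZ.2; have [K bK] := bD.2.
suff main m : `|Ex (fun w => Z w * D w)| <= `|K| / m.+1%:R.
  apply/eqP; apply: contrapT => /eqP; rewrite -normr_gt0 => e0.
  have := main (Num.trunc (`|K| / `|Ex (fun w => Z w * D w)|)).
  rewrite ler_pdivlMr ?ltr0n// mulrC -ler_pdivlMr//.
  apply/negP; rewrite -ltNge; exact: truncnS_gt.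
have m0 : 0 < m.+1%:R :> R by rewrite ltr0n.
(* [Zn] rounds [Z] down to the grid of step [1 / m.+1] that starts at [- C] *)
pose tr w := Num.trunc (m.+1%:R * (Z w + C)).
pose J := (Num.trunc (m.+1%:R * (C + C))).+1.
pose a j : R := j%:R / m.+1%:R - C.
pose H j := [set w | (j%:R <= m.+1%:R * (Z w + C) < j.+1%:R)].
have GH j : G (H j).
  rewrite -(sigma_algebra_id sG).
  have mZ : meas_wrt G (fun w => m.+1%:R * (Z w + C)).
    by apply: (proj1 _); apply: bddrvZ; apply: bddrvD => //; apply: bddrv_cst.
  have := mZ measurableT _ (measurable_itv `[j%:R, j.+1%:R[).
  by rewrite setTI; congr (_.-sigma.-measurable _); apply/seteqP; split=> w /=;
     rewrite in_itv.
pose Zn w := \sum_(j < J) a j * \1_(H j) w.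
have bZn : bddrv full Zn.
  by apply: bddrv_sum => j _; apply: bddrvZ; apply: bddrv_indic; apply/Gm.
have -> : Ex (fun w => Z w * D w) = Ex (fun w => (Z w - Zn w) * D w).
  under [in RHS]eq_fun do rewrite mulrBl.
  rewrite ExB; try exact: bddrvM.
  rewrite [X in _ = _ - X](_ : _ = 0) ?subr0//.
  under eq_fun do rewrite mulr_suml.
  have bj j : bddrv full (fun w => \1_(H j) w * D w).
    by apply: bddrvM => //; apply: bddrv_indic; apply/Gm.
  under eq_fun do under eq_bigr do rewrite -mulrA.
  rewrite Ex_sum => [|j _]; last exact: bddrvZ.
  by rewrite big1// => j _; rewrite ExZ// D0// mulr0.
have le1 : {ae P, forall w, `|(Z w - Zn w) * D w| <= `|K| / m.+1%:R}.
  apply: filterS2 bC bK => w hC hK.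
  have h0 : 0 <= m.+1%:R * (Z w + C).
    by rewrite mulr_ge0 ?ler0n//; move: hC; rewrite ler_norml; lra.
  have /andP[t1 t2] := truncn_itv h0.
  have tJ : (tr w < J)%N.
    rewrite ltnS; apply: le_truncn; rewrite ler_pM2l//.
    by move: hC; rewrite ler_norml; lra.
  have -> : Zn w = a (tr w).
    rewrite /Zn (bigD1 (Ordinal tJ))//= big1 ?addr0 => [|j jt].
      by rewrite indicE mem_set ?mulr1//; apply/andP.
    rewrite indicE memNset ?mulr0// => /andP[j1 j2]; case/eqP: jt.
    apply/val_inj => /=; apply/eqP; rewrite eqn_leq.
    rewrite -ltnS -[X in _ && X]ltnS -(ltr_nat R) -[X in _ && X](ltr_nat R).
    by rewrite (le_lt_trans j1 t2) (le_lt_trans t1 j2).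
  rewrite normrM mulrC; apply: ler_pM => //; first exact: le_trans hK (ler_norm _).
  have -> : Z w - a (tr w) = (m.+1%:R * (Z w + C) - (tr w)%:R) / m.+1%:R.
    by rewrite /a; field; rewrite lt0r_neq0.
  rewrite normrM normfV (gtr0_norm m0) ler_pdivrMr// mulVf ?lt0r_neq0//.
  rewrite ler_norml; move: t1 t2; rewrite -/(tr w) -addn1 natrD; lra.
have bE : bddrv full (fun w => (Z w - Zn w) * D w).
  by apply: bddrvM => //; exact: bddrvB.
have bc := bddrv_cst full (`|K| / m.+1%:R); have bNc := bddrvN bc.
rewrite ler_norml; apply/andP; split.
  by rewrite -[X in X <= _]Ex_cst; apply: Ex_le => //;
     apply: filterS le1 => w; rewrite ler_norml => /andP[].
by rewrite -[X in _ <= X]Ex_cst; apply: Ex_le => //;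
   apply: filterS le1 => w; rewrite ler_norml => /andP[].
Qed.

Lemma condeq_refl G X : condeq G X X.
Proof. by []. Qed.

Lemma condeq_eq G X X' Y Y' : X =1 X' -> Y =1 Y' ->
  condeq G X Y -> condeq G X' Y'.
Proof. by move=> /funext -> /funext ->. Qed.

Lemma condeq_trans G X Y Z : condeq G X Y -> condeq G Y Z -> condeq G X Z.
Proof. by move=> XY YZ W bW; rewrite XY// YZ. Qed.

Lemma condeq_sub G G' X Y : G `<=` G' -> condeq G' X Y -> condeq G X Y.
Proof. by move=> GG' XY Z bZ; apply: XY; apply: bddrv_sub bZ. Qed.

Lemma condeq_Ex G X Y : condeq G X Y -> Ex X = Ex Y.
Proof.
move=> /(_ _ (bddrv_cst G 1)).
by under eq_fun do rewrite mul1r; under [in RHS]eq_fun do rewrite mul1r.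
Qed.

Lemma condeqD G X X' Y Y' : G `<=` full ->
  bddrv full X -> bddrv full X' -> bddrv full Y -> bddrv full Y' ->
  condeq G X Y -> condeq G X' Y' ->
  condeq G (fun w => X w + X' w) (fun w => Y w + Y' w).
Proof.
move=> Gf bX bX' bY bY' XY XY' Z bGZ; have bZ := bddrv_sub Gf bGZ.
under eq_fun do rewrite mulrDr.
under [in RHS]eq_fun do rewrite mulrDr.
by rewrite !ExD ?XY ?XY'//; exact: bddrvM.
Qed.

Lemma condeqM G W X Y : bddrv G W -> condeq G X Y ->
  condeq G (fun w => W w * X w) (fun w => W w * Y w).
Proof.
move=> bW XY Z bZ.
under eq_fun do rewrite mulrA.
under [in RHS]eq_fun do rewrite mulrA.
by apply: XY; exact: bddrvM.
Qed.

Lemma condeqZ G c X Y : condeq G X Y ->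
  condeq G (fun w => c * X w) (fun w => c * Y w).
Proof. by apply: condeqM; exact: bddrv_cst. Qed.

Lemma condeqB G X X' Y Y' : G `<=` full ->
  bddrv full X -> bddrv full X' -> bddrv full Y -> bddrv full Y' ->
  condeq G X Y -> condeq G X' Y' ->
  condeq G (fun w => X w - X' w) (fun w => Y w - Y' w).
Proof.
move=> Gf bX bX' bY bY' XY XY'; apply: condeqD => //; try exact: bddrvN.
by apply: condeq_eq (condeqZ (-1) XY') => w; rewrite mulN1r.
Qed.

Lemma condeq_sum G (J : Type) (r : seq J) (p : pred J) (X Y : J -> T -> R) :
  G `<=` full ->
  (forall j, p j -> bddrv full (X j)) -> (forall j, p j -> bddrv full (Y j)) ->
  (forall j, p j -> condeq G (X j) (Y j)) ->
  condeq G (fun w => \sum_(j <- r | p j) X j w) (fun w => \sum_(j <- r | p j) Y j w).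
Proof.
move=> Gf bX bY XY; elim: r => [|j r IH].
  by apply: condeq_eq (@condeq_refl G (fun=> 0)) => w; rewrite big_nil.
case pj: (p j); last by apply: condeq_eq IH => w; rewrite big_cons pj.
apply: condeq_eq (condeqD Gf (bX _ pj) _ (bY _ pj) _ (XY _ pj) IH);
  try exact: bddrv_sum; by move=> w; rewrite big_cons pj.
Qed.

Lemma meas_wrtP G X : (forall B, measurable B -> G (X @^-1` B)) -> meas_wrt G X.
Proof.
by move=> GX _ B mB; rewrite setTI; apply: sub_sigma_algebra; exact: GX.
Qed.

Lemma meas_wrt_comp G d' (V : measurableType d') (U : T -> V) (phi : V -> R) :
  measurable_fun setT phi ->
  (forall A, measurable A -> G (U @^-1` A)) -> meas_wrt G (phi \o U).
Proof.
move=> mphi GU; apply: meas_wrtP => B mB; rewrite comp_preimage; apply: GU.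
by rewrite -[X in measurable X]setTI; exact: mphi.
Qed.

End BoundedRV.

Section SameLaw.
Context {R : realType} {d d' : measure_display}.
Context {T : measurableType d} {V : measurableType d'}.
Variables (P : probability T R) (mu : probability V R) (U : T -> V).
Hypothesis mU : measurable_fun setT U.
Hypothesis lawU : forall A, measurable A -> P (U @^-1` A) = mu A.

Lemma same_law_ae (Q : V -> Prop) :
  {ae mu, forall x, Q x} -> {ae P, forall w, Q (U w)}.
Proof.
move=> [N [mN N0 QN]]; exists (U @^-1` N); split.
- by rewrite -[X in measurable X]setTI; exact: mU.
- by rewrite lawU.
- by move=> w nQ; apply: QN.
Qed.

Lemma same_law_bddrv (G : set (set T)) (phi : V -> R) :
  (forall A, measurable A -> G (U @^-1` A)) ->
  bddrv mu (@measurable _ V) phi -> bddrv P G (phi \o U).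
Proof.
move=> GU [/meas_wrt_full mphi [C bphi]]; split; first exact: meas_wrt_comp.
by exists C; exact: (same_law_ae bphi).
Qed.

Lemma same_law_Ex (phi : V -> R) : bddrv mu (@measurable _ V) phi ->
  Ex P (phi \o U) = Ex mu phi.
Proof.
move=> bphi; have mphi := (meas_wrt_full phi).1 bphi.1.
have GU A : measurable A -> measurable (U @^-1` A).
  by move=> mA; rewrite -[X in measurable X]setTI; exact: mU.
pose mixU := isMeasurableFun.Build _ _ _ _ U mU.
pose UU : {mfun T >-> V} := HB.pack U mixU.
have /bddrv_integrable iphi := same_law_bddrv GU bphi.
have := @integral_distribution _ _ T V R P UU (EFin \o phi).
rewrite /Ex /Rintegral => <-; [|exact/measurable_EFinP|exact: iphi].
congr fine; apply: eq_measure_integral => A mA _.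
exact: lawU.
Qed.

End SameLaw.

Section Independence.
Context {R : realType} {d d' : measure_display}.
Context {T : measurableType d} {V : measurableType d'}.
Variables (P : probability T R) (mu : probability V R) (U : T -> V).
Hypothesis mU : measurable_fun setT U.
Local Notation full := (@measurable d T).

Lemma measurable_preimage A : measurable A -> measurable (U @^-1` A).
Proof. by move=> mA; rewrite -[X in measurable X]setTI; exact: mU. Qed.

Lemma preimage_sub_sigma_algebra :
  Defs.sub_sigma_algebra (preimage_set_system setT U (@measurable _ V)).
Proof.
split; first by apply: sigma_algebra_preimage; exact: sigma_algebra_measurable.
by move=> _ [A mA <-]; apply: measurableI => //; exact: measurable_preimage.
Qed.

(** A variable [W] that is uncorrelated with all events [U \in A] is uncorrelated
    with all bounded functions of [U]: on the sigma-algebra generated by [U], its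
    conditional mean is constant. *)
Lemma indep_Ex (W : T -> R) (c : R) (phi : V -> R) :
  (forall A, measurable A -> P (U @^-1` A) = mu A) ->
  bddrv P full W ->
  (forall A, measurable A -> Ex P (fun w => \1_(U @^-1` A) w * W w) = c * fine (mu A)) ->
  bddrv mu (@measurable _ V) phi ->
  Ex P (fun w => phi (U w) * W w) = c * Ex mu phi.
Proof.
move=> lawU bW hW bphi.
have GU A : measurable A -> preimage_set_system setT U (@measurable _ V) (U @^-1` A).
  by move=> mA; exists A => //; rewrite setTI.
have cW : condeq P (preimage_set_system setT U (@measurable _ V)) W (fun=> c).
  apply: condeq_of_sets => //; first exact: preimage_sub_sigma_algebra.
    exact: bddrv_cst.
  move=> _ [A mA <-]; rewrite setTI hW//.
  have mUA := measurable_preimage mA.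
  rewrite (_ : (fun w => _) = (fun w => c * \1_(U @^-1` A) w)).
    by rewrite ExZ ?Ex_indic ?lawU//; exact: bddrv_indic.
  by apply/funext => w; rewrite mulrC.
have bU := same_law_bddrv mU lawU GU bphi.
have bUf := same_law_bddrv mU lawU measurable_preimage bphi.
rewrite (cW _ bU) (_ : (fun w => _) = (fun w => c * (phi \o U) w)).
  by rewrite ExZ// (same_law_Ex mU lawU).
by apply/funext => w /=; rewrite mulrC.
Qed.

End Independence.

(** * The multilinear extension *)

Section Multilinear.
Context {R : realType} {Omega : finType}.
Implicit Types (f g h : {set Omega} -> R) (x y z : Omega -> R) (A S X : {set Omega}).

Local Notation F := multilinear_ext.

Definition in_cube x : Prop := forall k, 0 <= x k <= 1.

Lemma prodrD_set (a b : Omega -> R) :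
  \prod_i (a i + b i) = \sum_(S : {set Omega}) \prod_i (if i \in S then a i else b i).
Proof. by rewrite bigA_distr; apply: eq_bigl => S; rewrite inE. Qed.

Lemma sample_probE x S :
  sample_prob x S = \prod_k (if k \in S then x k else 1 - x k).
Proof.
rewrite /sample_prob [RHS](bigID (fun k => k \in S))/=; congr (_ * _).
  by apply: eq_bigr => k ->.
by apply: eq_big => k; rewrite ?inE /=; last by move=> /negbTE ->. 
Qed.

Lemma sum_sample_prob x : \sum_S sample_prob x S = 1.
Proof.
under eq_bigr do rewrite sample_probE.
rewrite -(prodrD_set x (fun k => 1 - x k)).
by rewrite big1// => k _; rewrite addrC subrK.
Qed.

Lemma sample_prob_ge0 x S : in_cube x -> 0 <= sample_prob x S.
Proof.
move=> xc; rewrite sample_probE prodr_ge0// => k _.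
by case: ifP => _; have /andP[] := xc k; lra.
Qed.

Lemma multilinear_ext_cst c x : F (fun=> c) x = c.
Proof. by rewrite /F -mulr_sumr sum_sample_prob mulr1. Qed.

Lemma multilinear_ext_sum (J : Type) (r : seq J) (p : pred J)
    (h : J -> {set Omega} -> R) x :
  F (fun S => \sum_(j <- r | p j) h j S) x = \sum_(j <- r | p j) F (h j) x.
Proof.
rewrite /F exchange_big/=; apply: eq_bigr => S _.
by rewrite mulr_suml.
Qed.

Lemma multilinear_extB f g x : F (fun S => f S - g S) x = F f x - F g x.
Proof. by rewrite /F -sumrB; apply: eq_bigr => S _; rewrite mulrBl. Qed.

Lemma le_multilinear_ext f g x : in_cube x -> (forall S, f S <= g S) ->
  F f x <= F g x.
Proof.
by move=> xc fg; apply: ler_sum => S _; rewrite ler_wpM2r// sample_prob_ge0.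
Qed.

Lemma multilinear_ext_ge0 f x : in_cube x -> (forall S, 0 <= f S) -> 0 <= F f x.
Proof. by move=> xc f0; rewrite -(multilinear_ext_cst 0 x) le_multilinear_ext. Qed.

Lemma normr_multilinear_ext f x C : in_cube x -> (forall S, `|f S| <= C) ->
  `|F f x| <= C.
Proof.
move=> xc fC; rewrite ler_norml -{1}(multilinear_ext_cst (- C) x).
rewrite -{2}(multilinear_ext_cst C x) !le_multilinear_ext//;
  by move=> S; move: (fC S); rewrite ler_norml => /andP[].
Qed.

(** The multilinear extension of [setder f k] is the partial derivative in [k] of
    the multilinear extension of [f], see [multilinear_ext_shift]. *)
Definition setder f k : {set Omega} -> R := fun S => f (k |: S) - f (S :\ k).

Definition shift x k (t : R) : Omega -> R := fun i => x i + t * (i == k)%:R.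

(** Conditioning on whether [k] is drawn exhibits [F] as affine in [x k]. *)
Lemma multilinear_ext_split h k x : F h x =
  \sum_(S : {set Omega} | k \notin S)
     (x k * h (k |: S) + (1 - x k) * h S)
     * \prod_(i | i != k) (if i \in S then x i else 1 - x i).
Proof.
rewrite /F (bigID (fun S => k \in S))/=.
rewrite (reindex_onto (fun S => k |: S) (fun S => S :\ k))/=; last first.
  by move=> S kS; rewrite finset.setD1K.
rewrite [X in X + _](_ : _ = \sum_(S : {set Omega} | k \notin S)
     (h (k |: S) * x k) * \prod_(i | i != k) (if i \in S then x i else 1 - x i)).
  rewrite -big_split/=; apply: eq_bigr => S kS.
  rewrite sample_probE [\prod_k0 _](bigD1 k)//= (negbTE kS); ring.
apply: eq_big => S.
  rewrite finset.setU11/=; apply/eqP/idP => [<-|kS]; first by rewrite !inE eqxx.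
  by rewrite finset.setU1K.
rewrite finset.setU11/= => /eqP E; rewrite sample_probE (bigD1 k)//= finset.setU11 mulrA.
congr (_ * _); apply: eq_bigr => i ik.
by rewrite !inE (negbTE ik).
Qed.

Lemma multilinear_ext_shift f x k t : F f (shift x k t) = F f x + t * F (setder f k) x.
Proof.
rewrite !(multilinear_ext_split _ k) mulr_sumr -big_split/=.
apply: eq_bigr => S kS; rewrite /shift eqxx mulr1.
rewrite [X in _ * X = _](eq_bigr (fun i => if i \in S then x i else 1 - x i)).
  rewrite /setder [k |: (k |: S)](_ : _ = k |: S); last first.
    by apply/setP => i; rewrite !inE; case: eqP.
  rewrite [(k |: S) :\ k](_ : _ = S); last by rewrite finset.setU1K.
  rewrite [S :\ k](_ : _ = S); first ring.
  by apply/setP => i; rewrite !inE; case: eqP => // ->; rewrite (negbTE kS).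
by move=> i /negbTE ->; rewrite mulr0 addr0.
Qed.

Lemma setder_setder_same f k S : setder (setder f k) k S = 0.
Proof.
rewrite /setder [k |: (k |: S)](_ : _ = k |: S); last first.
  by apply/setP => i; rewrite !inE; case: eqP.
rewrite [(k |: S) :\ k](_ : _ = S :\ k); last first.
  by apply/setP => i; rewrite !inE; case: eqP.
rewrite [k |: (S :\ k)](_ : _ = k |: S); last first.
  by apply/setP => i; rewrite !inE; case: eqP.
rewrite [(S :\ k) :\ k](_ : _ = S :\ k) ?subrr//.
by apply/setP => i; rewrite !inE; case: eqP.
Qed.

Lemma setder_bounds f M k S : monotone_set_fun f -> (forall A, 0 <= f A <= M) ->
  0 <= setder f k S <= M.
Proof.
move=> mf bf; rewrite /setder.
have h : f (S :\ k) <= f (k |: S).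
  by apply: mf; apply/fintype.subsetP => i; rewrite !inE => /andP[_ ->]; rewrite orbT.
have /andP[a1 a2] := bf (S :\ k); have /andP[b1 b2] := bf (k |: S).
by apply/andP; split; lra.
Qed.

Lemma normr_setder_setder f M k j S : monotone_set_fun f ->
  (forall A, 0 <= f A <= M) -> `|setder (setder f k) j S| <= M.
Proof.
move=> mf bf; rewrite {1}/setder ler_norml.
have /andP[a1 a2] := setder_bounds k (S :\ j) mf bf.
have /andP[b1 b2] := setder_bounds k (j |: S) mf bf.
by apply/andP; split; lra.
Qed.

(** Intermediate points when [y] is moved to [z] one coordinate at a time; each
    move changes [F] affinely. *)
Definition mix (s : seq Omega) y z : Omega -> R :=
  fun k => if k \in s then z k else y k.

Lemma mix_cons s j y z : j \notin s ->
  mix (j :: s) y z = shift (mix s y z) j (z j - y j).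
Proof.
move=> js; apply/funext => k; rewrite /mix /shift inE.
by case: eqP => [->|_] /=; rewrite ?(negbTE js) ?mulr1 ?mulr0 ?addr0// addrC subrK.
Qed.

Lemma in_cube_mix s y z : in_cube y -> in_cube z -> in_cube (mix s y z).
Proof. by move=> yc zc k; rewrite /mix; case: ifP. Qed.

Lemma multilinear_ext_lip f y z (B : Omega -> R) :
  in_cube y -> in_cube z -> (forall j S, `|setder f j S| <= B j) ->
  `|F f z - F f y| <= \sum_j B j * `|z j - y j|.
Proof.
move=> yc zc fB.
suff main s : uniq s ->
    `|F f (mix s y z) - F f y| <= \sum_(j <- s) B j * `|z j - y j|.
  have := main _ (enum_uniq Omega); rewrite big_enum/=.
  by rewrite (_ : mix _ y z = z)//; apply/funext => k; rewrite /mix mem_enum.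
elim: s => [_|j s IH /= /andP[js us]].
  by rewrite (_ : mix [::] y z = y)// subrr normr0 big_nil.
rewrite mix_cons// multilinear_ext_shift big_cons addrAC addrC.
apply: le_trans (ler_normD _ _) _; apply: lerD; last exact: IH.
rewrite normrM mulrC ler_wpM2r//; apply: normr_multilinear_ext => //.
exact: in_cube_mix.
Qed.

(** Second-order expansion along the coordinate path from [y] to [z]: the partial
    derivative in [k] moves by at most [M] times the displacement of the other
    coordinates, as the mixed second differences of [f] are at most [M]. *)
Lemma multilinear_ext_taylor f M y z : monotone_set_fun f ->
  (forall A, 0 <= f A <= M) ->
  in_cube y -> in_cube z -> (forall k, y k <= z k) ->
  F f y + \sum_k (z k - y k) * F (setder f k) y
    - M * \sum_k (z k - y k) * \sum_(j | j != k) (z j - y j) <= F f z.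
Proof.
move=> mf bf yc zc yz.
pose v k := F (setder f k) y - M * \sum_(j | j != k) (z j - y j).
suff main s : uniq s ->
    \sum_(k <- s) (z k - y k) * v k <= F f (mix s y z) - F f y.
  have := main _ (enum_uniq Omega); rewrite big_enum/=.
  rewrite (_ : mix _ y z = z); last by apply/funext => k; rewrite /mix mem_enum.
  rewrite (eq_bigr (fun k => (z k - y k) * F (setder f k) y
      - M * ((z k - y k) * \sum_(j | j != k) (z j - y j)))); last first.
    by move=> k _; rewrite /v; ring.
  by rewrite sumrB -mulr_sumr; lra.
elim: s => [_|k s IH /= /andP[ks us]].
  by rewrite (_ : mix [::] y z = y)// subrr big_nil.
rewrite mix_cons// multilinear_ext_shift big_cons addrAC addrC.
apply: lerD; last exact: IH.
apply: ler_wpM2l; first by rewrite subr_ge0.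
rewrite /v lerBlDr -lerBlDl.
pose B j := if j == k then 0 else M.
have fB j S : `|setder (setder f k) j S| <= B j.
  rewrite /B; case: eqP => [->|_]; first by rewrite setder_setder_same normr0.
  exact: normr_setder_setder.
have M0 : 0 <= M by have /andP[] := bf finset.set0; apply: le_trans.
have := multilinear_ext_lip (in_cube_mix s yc zc) yc fB.
have : \sum_j B j * `|y j - mix s y z j| <= M * \sum_(j | j != k) (z j - y j).
  rewrite (bigD1 k)//= /B eqxx mul0r add0r mulr_sumr; apply: ler_sum => j jk.
  rewrite (negbTE jk); apply: ler_wpM2l => //.
  have h : 0 <= z j - y j by rewrite subr_ge0.
  rewrite /mix distrC.
  by case: ifP => _; [rewrite ger0_norm | rewrite subrr normr0].
rewrite -/(B) => h1 h2; have := le_trans h2 h1; rewrite ler_norml => /andP[_].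
lra.
Qed.

(** The inequality behind the factor [1 - 1/e]: already for each set [S], the
    marginal gains of the elements of [X] add up to at least [f X - f S]. *)
Lemma sum_setder_ge f X y : (forall A, 0 <= f A) -> monotone_set_fun f ->
  submodular f -> in_cube y ->
  f X - F f y <= \sum_(k in X) F (setder f k) y.
Proof.
move=> f0 mf sf yc.
rewrite -{1}(multilinear_ext_cst (f X) y) -multilinear_extB -multilinear_ext_sum.
apply: le_multilinear_ext => // S.
have step s : f (S :|: [set k in s]) - f S <= \sum_(k <- s) setder f k S.
  elim: s => [|k s IH].
    rewrite big_nil (_ : S :|: _ = S) ?subrr//.
    by apply/setP => i; rewrite !inE orbF.
  rewrite big_cons.
  have hk : f (k |: S) - f S <= setder f k S.
    by rewrite /setder lerD2l lerN2; apply: mf; apply/fintype.subsetP => i; rewrite !inE => /andP[].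
  have -> : S :|: [set i in k :: s] = k |: (S :|: [set i in s]).
    by apply/setP => i; rewrite !inE; case: (i == k); rewrite ?orbT.
  have : f (k |: (S :|: [set i in s])) - f (S :|: [set i in s]) <= f (k |: S) - f S.
    have [kS|kS] := boolP (k \in S :|: [set i in s]).
      rewrite (_ : k |: (S :|: _) = S :|: [set i in s]); last first.
        by apply/setP => i; move: kS; rewrite !inE; case: eqP => // ->.
      rewrite subrr subr_ge0; apply: mf; apply/fintype.subsetP => i; rewrite !inE => ->.
      by rewrite orbT.
    by apply: sf => //; apply/fintype.subsetP => i; rewrite !inE => ->.
  move: IH hk; lra.
have := step (enum X); rewrite big_enum/=; apply: le_trans; rewrite lerD2r.
by apply: mf; apply/fintype.subsetP => i iX; rewrite !inE mem_enum iX orbT.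
Qed.

(** Taylor coefficients of the multilinear extension at [y]: the derivative of
    [F] at [y] in the coordinates of [A], one factor [1] or [-1] for each
    differentiated [x_i] or [1 - x_i]. *)
Definition coef f y A : R :=
  \sum_S f S * \prod_i (if i \in A then (if i \in S then 1 else -1)
                        else (if i \in S then y i else 1 - y i)).

Lemma prod_set_mkcond A (a : Omega -> R) :
  \prod_(i in A) a i = \prod_i (if i \in A then a i else 1).
Proof. by rewrite big_mkcond. Qed.

Lemma multilinear_ext_expand f y z :
  F f (fun k => y k + z k) = \sum_A coef f y A * \prod_(i in A) z i.
Proof.
rewrite /coef; under [RHS]eq_bigr do rewrite mulr_suml.
rewrite exchange_big/=; apply: eq_bigr => S _.
rewrite sample_probE (eq_bigr (fun i =>
  (if i \in S then 1 else -1) * z i + (if i \in S then y i else 1 - y i))).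
  rewrite prodrD_set mulr_sumr; apply: eq_bigr => A _.
  rewrite -mulrA prod_set_mkcond -big_split/=; congr (_ * _).
  by apply: eq_bigr => i _; case: ifP => _; rewrite ?mulr1.
by move=> i _; case: ifP => _; ring.
Qed.

Lemma coef0 f y : coef f y finset.set0 = F f y.
Proof.
rewrite /coef; apply: eq_bigr => S _; rewrite sample_probE.
by congr (_ * _); apply: eq_bigr => i _; rewrite inE.
Qed.

Lemma coef1 f y k : coef f y [set k]%SET = F (setder f k) y.
Proof.
have := multilinear_ext_shift f y k 1; rewrite mul1r.
rewrite /shift multilinear_ext_expand (bigD1 finset.set0)//= coef0 big_set0 mulr1.
rewrite (bigD1 [set k]%SET)/=; last first.
  by apply/eqP => /setP/(_ k); rewrite !inE eqxx.
rewrite big_set1 eqxx !mulr1 big1 ?addr0; first by move/addrI.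
move=> A /andP[A0 Ak].
suff [i /andP[iA ik]] : exists i, (i \in A) && (i != k).
  by rewrite (bigD1 i)//= (negbTE ik) mulr0 mul0r mulr0.
apply/existsP; apply: contraT; rewrite negb_exists => /forallP h.
case/negP: Ak; apply/eqP/setP => i; rewrite inE.
have [->|ik] := eqVneq i k; last first.
  by have := h i; rewrite ik andbT => /negbTE.
case/set0Pn: A0 => j jA; have := h j; rewrite jA negbK => /eqP <-.
by rewrite jA.
Qed.

(** Walsh characters, where [E] is the set of coordinates with sign [-1]. *)
Definition chi A (E : {set Omega}) : R := \prod_(i in A) (-1) ^+ (i \in E).

Lemma chi_orth A B :
  \sum_E chi A E * chi B E = if A == B then #|{set Omega}|%:R else 0.
Proof.
case: eqP => [->|/eqP AB].
  rewrite -sum1_card natr_sum; apply: eq_bigr => E _.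
  rewrite /chi -big_split/= big1// => i _.
  by rewrite -expr2 sqrr_sign.
rewrite (eq_bigr (fun E : {set Omega} => \prod_i (if i \in E
   then (-1) ^+ (i \in A) * (-1) ^+ (i \in B) else 1))); last first.
  move=> E _; rewrite /chi !prod_set_mkcond -big_split/=; apply: eq_bigr => i _.
  by case: (i \in A); case: (i \in B); case: (i \in E) => /=;
     rewrite ?expr0 ?expr1 ?mulr1 ?mul1r.
rewrite -prodrD_set.
have [i iAB] : exists i, (i \in A) != (i \in B).
  apply/existsP; apply: contraT; rewrite negb_exists => /forallP h.
  by case/eqP: AB; apply/setP => i; apply/eqP; have := h i; rewrite negbK.
rewrite (bigD1 i)//=; move: iAB; case: (i \in A); case: (i \in B) => // _;
  by rewrite /= expr0 expr1 ?mulr1 ?mul1r addNr mul0r.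
Qed.

Lemma parseval (p : pred {set Omega}) (a : {set Omega} -> R) :
  \sum_E (\sum_(A | p A) a A * chi A E) ^+ 2
    = #|{set Omega}|%:R * \sum_(A | p A) a A ^+ 2.
Proof.
under eq_bigr do rewrite expr2 mulr_suml.
rewrite exchange_big/= mulr_sumr; apply: eq_bigr => A pA.
under eq_bigr do rewrite mulr_sumr.
rewrite exchange_big/= (bigD1 A)//= [X in _ + X]big1 ?addr0 => [|B /andP[_ BA]].
  transitivity (a A ^+ 2 * \sum_E chi A E * chi A E).
    by rewrite mulr_sumr; apply: eq_bigr => E _; ring.
  by rewrite chi_orth eqxx mulrC.
transitivity (a A * a B * \sum_E chi A E * chi B E).
  by rewrite mulr_sumr; apply: eq_bigr => E _; ring.
by rewrite chi_orth eq_sym (negbTE BA) mulr0.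
Qed.

Definition flip (E : {set Omega}) z : Omega -> R := fun i => (-1) ^+ (i \in E) * z i.

Lemma prod_flip A E z : \prod_(i in A) flip E z i = (\prod_(i in A) z i) * chi A E.
Proof. by rewrite /flip big_split/= mulrC. Qed.

(** By Parseval, the energy of the monomials containing [k] is the mean over sign
    patterns of the squared variation of [F] in coordinate [k], and the partial
    derivative of [F] lies in [[0, M]]. *)
Lemma influence_bound f M y z k : monotone_set_fun f ->
  (forall A, 0 <= f A <= M) ->
  (forall i, `|z i| <= y i <= 1 - `|z i|) ->
  \sum_(A : {set Omega} | k \in A) (coef f y A * \prod_(i in A) z i) ^+ 2 <= M ^+ 2 * z k ^+ 2.
Proof.
move=> mf bf yz.
have N0 : 0 < #|{set Omega}|%:R :> R.
  by rewrite ltr0n; apply/card_gt0P; exists finset.set0.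
rewrite -(ler_pM2l N0) -parseval.
have -> : #|{set Omega}|%:R * (M ^+ 2 * z k ^+ 2)
    = \sum_(E : {set Omega}) M ^+ 2 * z k ^+ 2.
  by rewrite sumr_const cardT -cardE mulr_natl.
apply: ler_sum => E _.
pose z' i := if i == k then 0 else flip E z i.
(* the coordinate [k] is frozen, so that the monomials containing [k] remain in
   the difference *)
pose y' i := y i + z' i.
have y'c : in_cube y'.
  move=> i; have := yz i; rewrite /y' /z' /flip.
  have [_|_] := eqVneq i k; first by have := normr_ge0 (z i); lra.
  have := lexx `|z i|; rewrite {1}ler_norml.
  by case: (i \in E); rewrite ?expr0 ?expr1; lra.
have E1 : F f (shift y' k (flip E z k)) - F f y'
    = \sum_(A : {set Omega} | k \in A) (coef f y A * \prod_(i in A) z i) * chi A E.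
  have -> : shift y' k (flip E z k) = (fun i => y i + flip E z i).
    apply/funext => i; rewrite /shift /y' /z'.
    by case: eqP => [->|_]; rewrite ?mulr1 ?mulr0 !addr0.
  rewrite !multilinear_ext_expand -sumrB [RHS]big_mkcond/=; apply: eq_bigr => A _.
  rewrite prod_flip; case: ifP => kA.
    by rewrite [X in _ - X](_ : _ = 0) ?subr0 ?mulrA// (bigD1 k)//= /z' eqxx mul0r mulr0.
  rewrite [\prod_(i in A) z' i](eq_bigr (flip E z)) ?prod_flip ?subrr// => i iA.
  by rewrite /z'; case: eqP iA => // ->; rewrite kA.
rewrite -E1 multilinear_ext_shift addrAC subrr add0r exprMn mulrC.
apply: ler_pM; rewrite ?sqr_ge0//.
  have h : 0 <= F (setder f k) y' <= M.
    have b S := setder_bounds k S mf bf.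
    rewrite multilinear_ext_ge0//=; last by move=> S; have /andP[] := b S.
    rewrite -(multilinear_ext_cst M y') le_multilinear_ext//.
    by move=> S; have /andP[] := b S.
  by have /andP[h0 h1] := h; rewrite ler_sqr ?nnegrE//; apply: le_trans h1.
by rewrite /flip exprMn sqrr_sign mul1r.
Qed.

(** An odd set is nonempty, hence each odd monomial is counted in the influence of
    at least one coordinate. *)
Lemma odd_energy_bound f M y z : monotone_set_fun f ->
  (forall A, 0 <= f A <= M) ->
  (forall i, `|z i| <= y i <= 1 - `|z i|) ->
  \sum_(A : {set Omega} | odd #|A|) (coef f y A * \prod_(i in A) z i) ^+ 2
    <= M ^+ 2 * \sum_k z k ^+ 2.
Proof.
move=> mf bf yz; rewrite mulr_sumr.
apply: (@le_trans _ _ (\sum_k \sum_(A : {set Omega} | k \in A)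
   (coef f y A * \prod_(i in A) z i) ^+ 2)); last first.
  by apply: ler_sum => k _; apply: influence_bound.
rewrite (exchange_big_dep predT)//= big_mkcond/=; apply: ler_sum => A _.
rewrite sumr_const; case: ifP => oA; last by rewrite mulrn_wge0// sqr_ge0.
case: #|A| oA => // n _.
by rewrite mulrS lerDl mulrn_wge0// sqr_ge0.
Qed.

End Multilinear.

(** * First- and second-order estimates on the cube *)

Section GradientEstimates.
Context {R : realType} {Omega : finType}.
Local Notation F := multilinear_ext.
Local Notation dim := (#|Omega|%:R : R).
Implicit Types (x y z h : Omega -> R) (f : {set Omega} -> R).

Lemma sum_others (k : Omega) (c : R) : \sum_(j | j != k) c = (dim - 1) * c.
Proof.
rewrite sumr_const -[_ *+ _]mulr_natl; congr (_ * _).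
have -> : #|[pred j | j != k]| = #|Omega|.-1 by rewrite -(cardC1 k); apply: eq_card.
have O0 : (0 < #|Omega|)%N by apply/card_gt0P; exists k.
by rewrite -[in RHS](prednK O0) -natr1 addrK.
Qed.

Lemma sqr_sum_others (k : Omega) (a : Omega -> R) :
  (\sum_(j | j != k) a j) ^+ 2 <= (dim - 1) * \sum_(j | j != k) a j ^+ 2.
Proof.
rewrite -(sum_others k) expr2 mulr_suml.
apply: (@le_trans _ _ (\sum_(i | i != k) \sum_(j | j != k) (a i ^+ 2 + a j ^+ 2) / 2)).
  apply: ler_sum => i _; rewrite mulr_sumr; apply: ler_sum => j _.
  have := sqr_ge0 (a i - a j); nra.
under eq_bigr do rewrite -mulr_suml big_split/= sum_others.
rewrite -mulr_suml big_split/= -mulr_sumr !sum_others.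
rewrite le_eqVlt; apply/orP; left; apply/eqP; lra.
Qed.

Lemma dim_sub1_ge0 : (0 < #|Omega|)%N -> 0 <= dim - 1.
Proof. by move=> O0; rewrite subr_ge0 ler1n. Qed.

(** The mixed second differences of [f] lie in [[-M, M]] and the pure ones vanish,
    hence the bound [M sqrt (d (d - 1))] on the Frobenius norm of the Hessian. *)
Lemma gradient_lip f M y z : (0 < #|Omega|)%N -> monotone_set_fun f ->
  (forall A, 0 <= f A <= M) -> in_cube y -> in_cube z ->
  \sum_k (F (setder f k) z - F (setder f k) y) ^+ 2
    <= dim * (dim - 1) * M ^+ 2 * \sum_k (z k - y k) ^+ 2.
Proof.
move=> O0 mf bf yc zc; have d1 := dim_sub1_ge0 O0.
have M0 : 0 <= M by have /andP[] := bf finset.set0; apply: le_trans.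
have step k : (F (setder f k) z - F (setder f k) y) ^+ 2
    <= (dim - 1) * M ^+ 2 * \sum_k (z k - y k) ^+ 2.
  pose B j := if j == k then 0 else M.
  have fB j S : `|setder (setder f k) j S| <= B j.
    rewrite /B; case: eqP => [->|_]; first by rewrite setder_setder_same normr0.
    exact: normr_setder_setder.
  have h := multilinear_ext_lip yc zc fB.
  have E : \sum_j B j * `|z j - y j| = M * \sum_(j | j != k) `|z j - y j|.
    rewrite (bigD1 k)//= /B eqxx mul0r add0r mulr_sumr; apply: eq_bigr => j jk.
    by rewrite (negbTE jk).
  rewrite E in h; rewrite -real_normK ?num_real//.
  apply: (@le_trans _ _ ((M * \sum_(j | j != k) `|z j - y j|) ^+ 2)).
    by rewrite ler_sqr ?nnegrE//; apply: le_trans h.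
  rewrite exprMn [(dim - 1) * _]mulrC -[leRHS]mulrA; apply: ler_wpM2l; first exact: sqr_ge0.
  apply: le_trans (sqr_sum_others _ _) _; apply: ler_wpM2l => //.
  rewrite [leRHS](bigD1 k)//= -[leLHS]add0r; apply: lerD; first exact: sqr_ge0.
  by apply: ler_sum => j _; rewrite real_normK ?num_real.
apply: le_trans (ler_sum _ (fun k _ => step k)) _.
by rewrite sumr_const -[X in X <= _]mulr_natl !mulrA.
Qed.

Lemma multilinear_ext_smooth f M y z : (0 < #|Omega|)%N -> monotone_set_fun f ->
  (forall A, 0 <= f A <= M) ->
  in_cube y -> in_cube z -> (forall k, y k <= z k) ->
  F f y + \sum_k (z k - y k) * F (setder f k) y
    - M * Num.sqrt (dim * (dim - 1)) * \sum_k (z k - y k) ^+ 2 <= F f z.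
Proof.
move=> O0 mf bf yc zc yz; have d1 := dim_sub1_ge0 O0.
have M0 : 0 <= M by have /andP[] := bf finset.set0; apply: le_trans.
apply: le_trans (multilinear_ext_taylor mf bf yc zc yz).
rewrite lerD2l lerN2 -mulrA; apply: ler_wpM2l => //.
apply: (@le_trans _ _ ((dim - 1) * \sum_k (z k - y k) ^+ 2)); last first.
  apply: ler_wpM2r; first by apply: sumr_ge0 => k _; exact: sqr_ge0.
  rewrite -[leLHS]ger0_norm// -sqrtr_sqr ler_wsqrtr//.
  by rewrite expr2; apply: ler_wpM2r => //; lra.
apply: (@le_trans _ _ (\sum_k \sum_(j | j != k) ((z k - y k) ^+ 2 + (z j - y j) ^+ 2) / 2)).
  apply: ler_sum => k _; rewrite mulr_sumr; apply: ler_sum => j _.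
  have := sqr_ge0 ((z k - y k) - (z j - y j)); nra.
under eq_bigr do rewrite -mulr_suml big_split/= sum_others.
rewrite -mulr_suml big_split/= -mulr_sumr.
have -> : \sum_i \sum_(j | j != i) (z j - y j) ^+ 2 = (dim - 1) * \sum_k (z k - y k) ^+ 2.
  rewrite (exchange_big_dep predT)//= mulr_sumr; apply: eq_bigr => j _.
  rewrite -(sum_others j); by apply: eq_bigl => i; rewrite eq_sym.
lra.
Qed.

End GradientEstimates.

(** * The matroid polytope and its transform *)

Section Polytope.
Context {R : realType} {Omega : finType}.
Implicit Types (x y : Omega -> R) (A S : {set Omega}) (I : {set {set Omega}}) (delta : R).

Lemma sum_sample_prob_mem x k :
  \sum_(S : {set Omega}) sample_prob x S * (k \in S)%:R = x k.
Proof.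
transitivity (multilinear_ext (fun S => (k \in S)%:R) x).
  by apply: eq_bigr => S _; rewrite mulrC.
rewrite (multilinear_ext_split _ k).
under eq_bigr => S kS do rewrite setU11 (negbTE kS) mulr1 mulr0 addr0.
rewrite -mulr_sumr -[RHS]mulr1; congr (_ * _).
transitivity (multilinear_ext (fun=> 1) x); last exact: multilinear_ext_cst.
rewrite (multilinear_ext_split _ k); apply: eq_bigr => S _.
by rewrite !mulr1 addrC subrK mul1r.
Qed.

(** Random thinning: from a random member [B] of [I], keep each [k] independently
    with probability [y k / x k]. *)
Lemma polytope_down I x y : (forall A B : {set Omega}, A \subset B -> B \in I -> A \in I) ->
  matroid_polytope I x -> (forall k, 0 <= y k <= x k) -> matroid_polytope I y.
Proof.
move=> dI [w [w0 w1 wx]] yx.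
(* where [x k = 0] also [y k = 0], and any probability would do *)
pose r k := if x k == 0 then 0 else y k / x k.
have rc : in_cube r.
  move=> k; rewrite /r; have /andP[y0 yxk] := yx k.
  case: eqP => [_|/eqP xk]; first by rewrite lexx ler01.
  have x0 : 0 < x k by rewrite lt0r xk (le_trans y0 yxk).
  by rewrite (divr_ge0 y0 (ltW x0)) ler_pdivrMr// mul1r.
have xr k : x k * r k = y k.
  rewrite /r; case: eqP => [xk|/eqP xk]; last by rewrite mulrC mulfVK.
  by have := yx k; rewrite xk mul0r => h; apply/eqP; rewrite eq_le.
pose w' A := \sum_(B in I) w B * \sum_(S : {set Omega}) sample_prob r S * (A == B :&: S)%:R.
have pick (g : {set Omega} -> R) : \sum_(A in I) w' A * g A
    = \sum_(B in I) w B * \sum_(S : {set Omega}) sample_prob r S * g (B :&: S).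
  rewrite /w'; under eq_bigr do rewrite mulr_suml.
  rewrite exchange_big/=; apply: eq_bigr => B BI.
  under eq_bigr do rewrite -mulrA mulr_suml.
  rewrite -mulr_sumr exchange_big/=; congr (_ * _); apply: eq_bigr => S _.
  rewrite (bigD1 (B :&: S))/=; last by apply: dI BI; exact: finset.subsetIl.
  rewrite eqxx mulr1 big1 ?addr0// => A /andP[_ /negbTE ->].
  by rewrite mulr0 mul0r.
exists w'; split.
- move=> A _; apply: sumr_ge0 => B BI; apply: mulr_ge0; first exact: w0.
  by apply: sumr_ge0 => S _; rewrite mulr_ge0 ?ler0n ?sample_prob_ge0.
- transitivity (\sum_(A in I) w' A * 1); first by apply: eq_bigr => A _; rewrite mulr1.
  rewrite pick -[RHS]w1; apply: eq_bigr => B _.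
  under eq_bigr do rewrite mulr1.
  by rewrite sum_sample_prob mulr1.
- move=> k; rewrite pick -xr wx mulr_suml; apply: eq_bigr => B _.
  rewrite -mulrA; congr (_ * _); rewrite -[in LHS](sum_sample_prob_mem r k) mulr_sumr.
  apply: eq_bigr => S _; rewrite /indicator inE; case: (k \in B) => /=.
    by rewrite mul1r.
  by rewrite mul0r mulr0.
Qed.

Lemma polytope_avg I (N : nat) (v : 'I_N -> Omega -> R) : (0 < N)%N ->
  (forall t, matroid_polytope I (v t)) ->
  matroid_polytope I (fun k => N%:R^-1 * \sum_t v t k).
Proof.
move=> N0 /choice[w hw].
have Nn0 : N%:R != 0 :> R by rewrite pnatr_eq0 -lt0n.
exists (fun A => N%:R^-1 * \sum_t w t A); split.
- move=> A AI; rewrite mulr_ge0 ?invr_ge0 ?ler0n// sumr_ge0// => t _.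
  by have [h _ _] := hw t; apply: h.
- rewrite -mulr_sumr exchange_big/= (eq_bigr (fun=> 1)).
    by rewrite sumr_const card_ord mulVf.
  by move=> t _; have [_ h _] := hw t.
- move=> k; under [RHS]eq_bigr do rewrite -mulrA mulr_suml.
  rewrite -mulr_sumr exchange_big/=; congr (_ * _); apply: eq_bigr => t _.
  by have [_ _ h] := hw t; rewrite h.
Qed.

Lemma transformed_set_avg I delta (N : nat) (v : 'I_N -> Omega -> R) : (0 < N)%N ->
  (forall t, transformed_set I delta (v t)) ->
  matroid_polytope I (fun k => N%:R^-1 * \sum_t v t k + delta).
Proof.
move=> N0 hv; have Nn0 : N%:R != 0 :> R by rewrite pnatr_eq0 -lt0n.
rewrite (_ : (fun k => _) = (fun k => N%:R^-1 * \sum_t (v t k + delta))).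
  by apply: polytope_avg => // t; have [] := hv t.
apply/funext => k; rewrite big_split/= mulrDr sumr_const card_ord -[delta *+ N]mulr_natl.
by rewrite mulrA mulVf// mul1r.
Qed.

Lemma transformed_set0 I delta : is_matroid I -> 0 <= delta ->
  transformed_set I delta !=set0 -> transformed_set I delta (fun=> 0).
Proof.
move=> [_ dI _] d0 [x [xb xI]]; split.
  by move=> k /=; have := xb k; lra.
apply: (polytope_down dI xI) => k /=; have := xb k; lra.
Qed.

(** In a decomposition of [delta * 1] the nonempty sets have total weight at most
    [delta d], the total size. Moving a part [s] of the weight of the empty set to
    [X] adds [s * 1_X] to [delta * 1] and stays in the polytope. *)
Lemma scaled_indicator_transformed I delta X : is_matroid I -> 0 <= delta ->
  (0 < #|Omega|)%N -> transformed_set I delta !=set0 -> X \in I ->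
  exists s : R, [/\ 0 <= s <= 1, 1 - 2 * delta * #|Omega|%:R <= s &
    transformed_set I delta (fun k => s * indicator X k)].
Proof.
move=> mI d0 O0 K0 XI.
have d1 : 1 <= #|Omega|%:R :> R by rewrite ler1n.
have dd : delta <= delta * #|Omega|%:R by rewrite ler_peMr.
have [k0 _] : exists k, k \in Omega.
  by move: O0 => /card_gt0P[k kO]; exists k.
have K00 := transformed_set0 mI d0 K0.
have d2 : 0 <= 1 - 2 * delta by have [/(_ k0)/andP[]] := K00.
have [_ [w [w0 w1 wx]]] := K00; have [I0 dI _] := mI.
have wk k : \sum_(A in I) w A * indicator A k = delta by rewrite -wx add0r.
have wE : 1 - delta * #|Omega|%:R <= w finset.set0.
  have E : \sum_(A in I) w A * #|A|%:R = delta * #|Omega|%:R.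
    transitivity (\sum_(k : Omega) \sum_(A in I) w A * indicator A k).
      rewrite exchange_big/=; apply: eq_bigr => A _.
      rewrite -mulr_sumr -sum1_card natr_sum big_mkcond/=; congr (_ * _).
      by apply: eq_bigr => k _; rewrite /indicator; case: (k \in A).
    by under eq_bigr do rewrite wk; rewrite sumr_const mulr_natr.
  rewrite -E lerBlDr -[leLHS]w1 (bigD1 finset.set0)//= lerD2l [leRHS](bigD1 finset.set0)//=.
  rewrite cards0 mulr0 add0r; apply: ler_sum => A /andP[AI A0].
  by apply: ler_peMr; [exact: w0|rewrite ler1n card_gt0].
(* the cap [1 - 2 delta] keeps the point in the cube of the transform *)
pose s := Num.min (w finset.set0) (1 - 2 * delta).
have s1 : s <= w finset.set0 by rewrite ge_min lexx.
have s2 : s <= 1 - 2 * delta by rewrite ge_min lexx orbT.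
have s0 : 0 <= s by rewrite le_min w0.
exists s; split.
- by rewrite s0/=; lra.
- by rewrite le_min; apply/andP; split; lra.
split=> [k /=|].
  rewrite /indicator; case: (k \in X); rewrite ?mulr1 ?mulr0 ?s0//=.
  by rewrite lexx.
have sum1 B (g : {set Omega} -> R) : B \in I ->
    \sum_(A in I) (A == B)%:R * g A = g B.
  move=> BI; rewrite (bigD1 B)//= eqxx mul1r big1 ?addr0// => A /andP[_ /negbTE ->].
  by rewrite mul0r.
exists (fun A => w A - s * (A == finset.set0)%:R + s * (A == X)%:R).
have lin (g : {set Omega} -> R) :
    \sum_(A in I) (w A - s * (A == finset.set0)%:R + s * (A == X)%:R) * g A
    = \sum_(A in I) w A * g A - s * g finset.set0 + s * g X.
  rewrite -(sum1 _ g I0) -(sum1 _ g XI) !mulr_sumr -sumrB -big_split/=.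
  by apply: eq_bigr => A _; ring.
split.
- move=> A AI; have [->|A0] := eqVneq A finset.set0.
    by rewrite mulr1 addr_ge0 ?subr_ge0// mulr_ge0.
  by rewrite mulr0 subr0 addr_ge0 ?w0// mulr_ge0.
- have := lin (fun=> 1); under eq_bigr do rewrite mulr1; move=> ->.
  by under eq_bigr do rewrite mulr1; rewrite w1; ring.
- move=> k; rewrite lin wk /indicator inE mulr0 subr0 addrC; ring.
Qed.

Lemma transformed_set_diam I delta x y : transformed_set I delta x ->
  transformed_set I delta y ->
  l2norm (fun k => x k - y k) <= diam (transformed_set I delta).
Proof.
move=> Kx Ky; apply: sup_upper_bound; last by exists x, y.
split; first by exists (l2norm (fun k => x k - y k)), x, y.
exists (Num.sqrt (\sum_(k : Omega) (1 - 2 * delta) ^+ 2)) => _ [x' [y' [[bx _] [bY _] ->]]].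
rewrite /l2norm ler_wsqrtr// /dotp; apply: ler_sum => k _.
have /andP[x0 x1] := bx k; have /andP[y0 y1] := bY k.
rewrite -expr2 -real_normK ?num_real// ler_sqr ?nnegrE//; last by lra.
by rewrite ler_norml; apply/andP; split; lra.
Qed.

Lemma dotp_ge0 x : 0 <= dotp x x.
Proof. by apply: sumr_ge0 => k _; rewrite -expr2 sqr_ge0. Qed.

Lemma cauchy_schwarz x y : dotp x y <= l2norm x * l2norm y.
Proof.
have E : dotp x y ^+ 2 <= dotp x x * dotp y y.
  have L : 0 <= \sum_i \sum_j (x i * y j - x j * y i) ^+ 2.
    by apply: sumr_ge0 => i _; apply: sumr_ge0 => j _; rewrite sqr_ge0.
  have prod (a b : Omega -> R) : (\sum_i a i) * (\sum_j b j) = \sum_i \sum_j a i * b j.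
    by rewrite mulr_suml; apply: eq_bigr => i _; rewrite mulr_sumr.
  have H : \sum_i \sum_j (x i * y j - x j * y i) ^+ 2
      = dotp x x * dotp y y + dotp y y * dotp x x - 2 * dotp x y ^+ 2.
    rewrite expr2 /dotp !prod mulr_sumr -big_split/= -sumrB; apply: eq_bigr => i _.
    rewrite mulr_sumr -big_split/= -sumrB; apply: eq_bigr => j _; ring.
  move: L; rewrite H; lra.
apply: le_trans (ler_norm _) _.
rewrite /l2norm -sqrtrM ?dotp_ge0// -sqrtr_sqr ler_wsqrtr//.
Qed.

End Polytope.

(** * Real inequalities *)

Section Numeric.
Context {R : realType}.

Lemma cbrt_cube (n : nat) : (n%:R `^ (1 / 3) : R) ^+ 3 = n%:R.
Proof.
by rewrite -powR_mulrn ?powR_ge0// -powRrM div1r mulVf ?powRr1// pnatr_eq0.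
Qed.

Lemma cbrt_sqr (n : nat) : (n%:R `^ (2 / 3) : R) = (n%:R `^ (1 / 3)) ^+ 2.
Proof.
by rewrite -powR_mulrn ?powR_ge0// -powRrM; congr (_ `^ _); field.
Qed.

Lemma cbrt_ge0 (n : nat) : 0 <= (n%:R `^ (1 / 3) : R).
Proof. exact: powR_ge0. Qed.

Lemma cbrt_gt0 (n : nat) : (0 < n)%N -> 0 < (n%:R `^ (1 / 3) : R).
Proof. by move=> n0; rewrite powR_gt0// ltr0n. Qed.

Lemma cbrt_le (m n : nat) : (m <= n)%N -> (m%:R `^ (1 / 3) : R) <= n%:R `^ (1 / 3).
Proof.
by move=> mn; apply: ge0_ler_powR; rewrite ?nnegrE ?ler0n ?ler_nat//; lra.
Qed.

(** Comparing cubes: with [a^3 = n] this is [(a^3 + 1)^2 <= (a^2 + 1)^3]. *)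
Lemma twothirds_succ (n : nat) : (0 < n)%N ->
  (n.+1%:R `^ (2 / 3) : R) <= n%:R `^ (2 / 3) + 1.
Proof.
move=> n0; rewrite !cbrt_sqr.
set b := n.+1%:R `^ _; set a := n%:R `^ _.
have a3 : a ^+ 3 = n%:R by exact: cbrt_cube.
have b3 : b ^+ 3 = a ^+ 3 + 1 by rewrite /b cbrt_cube a3 -natr1.
have b0 : 0 <= b by exact: cbrt_ge0.
have a0 : 0 <= a by exact: cbrt_ge0.
rewrite -(@ler_pXn2r _ 3)// ?nnegrE ?addr_ge0 ?sqr_ge0 ?ler01//.
rewrite -exprM mulnC exprM b3.
have -> : (a ^+ 2 + 1) ^+ 3 = (a ^+ 3 + 1) ^+ 2 + a ^+ 2 * (2 * a ^+ 2 + (a - 1) ^+ 2 + 2).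
  by ring.
by rewrite lerDl mulr_ge0 ?sqr_ge0//; nra.
Qed.

(** The induction step of the momentum recursion with weight [2 / p], where
    [p = n^(2/3)]. The drift [L / N^2] is at most [16 L / p^3] as [n <= 4 N], and
    [Q (p - 1) / p^2 <= Q / (p + 1)]. *)
Lemma momentum_recursion (n N : nat) (A Q L sig2 rho : R) :
  rho = 2 / n%:R `^ (2 / 3) ->
  (4 <= n)%N -> (n <= 4 * N)%N -> 0 <= L -> 0 <= sig2 ->
  4 * sig2 + 16 * L <= Q -> 0 <= A -> A <= Q / n%:R `^ (2 / 3) ->
  (1 - rho) ^+ 2 * ((1 + rho / 2) * A + (1 + 2 / rho) * (L / N%:R ^+ 2))
    + rho ^+ 2 * sig2 <= Q / n.+1%:R `^ (2 / 3).
Proof.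
move=> -> n4 nN L0 s0 hQ A0 AQ.
have n0 : (0 < n)%N by exact: (leq_trans _ n4).
have N0 : (0 < N)%N by case: N nN => //; rewrite muln0; case: n n0 {n4 AQ rho}.
have p'le := twothirds_succ n0.
have p'0 : 0 < n.+1%:R `^ (2 / 3) :> R by rewrite powR_gt0// ltr0n.
have p3 : (n%:R `^ (2 / 3) : R) ^+ 3 = n%:R ^+ 2.
  by rewrite cbrt_sqr -exprM mulnC exprM cbrt_cube.
have p0 : 0 < n%:R `^ (2 / 3) :> R by rewrite powR_gt0// ltr0n.
move: p'le p'0 p3 p0 AQ.
set p := n%:R `^ (2 / 3); set p' := n.+1%:R `^ (2 / 3) => p'le p'0 p3 p0 AQ.
have p2 : 2 < p.
  rewrite -(@ltr_pXn2r _ 3)// ?nnegrE ?ltW// p3.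
  have : 4 <= n%:R :> R by rewrite ler_nat.
  nra.
have Q0 : 0 <= Q by apply: le_trans hQ; lra.
have pn0 : p != 0 by rewrite lt0r_neq0.
have LN : L / N%:R ^+ 2 <= 16 * L / p ^+ 3.
  have hn : n%:R <= 4 * N%:R :> R by rewrite -natrM ler_nat.
  have n0R : 0 < n%:R :> R by rewrite ltr0n.
  have N0R : 0 < N%:R :> R by rewrite ltr0n.
  rewrite ler_pdivrMr ?exprn_gt0// mulrAC ler_pdivlMr ?exprn_gt0// p3.
  rewrite (_ : 16 * L * _ = L * (4 * N%:R) ^+ 2); last by ring.
  by apply: ler_wpM2l => //; rewrite ler_sqr ?nnegrE//; lra.
have h1 : (1 - 2 / p) ^+ 2 * (1 + 2 / p / 2) <= 1 - 2 / p.
  have r1 : 2 / p < 1 by rewrite ltr_pdivrMr// mul1r.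
  have r0 : 0 < 2 / p by rewrite divr_gt0.
  move: r1 r0; set r := 2 / p => r1 r0; nra.
have h2 : (1 - 2 / p) ^+ 2 * (1 + 2 / (2 / p)) <= p.
  rewrite (_ : _ * _ = (p - 2) ^+ 2 * (1 + p) / p ^+ 2); last by field.
  by rewrite ler_pdivrMr ?exprn_gt0//; nra.
have r1 : 0 <= 1 - 2 / p by rewrite subr_ge0 ler_pdivrMr// mul1r ltW.
have h3 : (1 - 2 / p) ^+ 2 * ((1 + 2 / p / 2) * A) <= (1 - 2 / p) * (Q / p).
  rewrite mulrA; apply: (@le_trans _ _ ((1 - 2 / p) * A)).
    by apply: ler_wpM2r.
  by apply: ler_wpM2l.
have h4 : (1 - 2 / p) ^+ 2 * ((1 + 2 / (2 / p)) * (L / N%:R ^+ 2)) <= p * (16 * L / p ^+ 3).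
  rewrite [leLHS]mulrA; apply: (@le_trans _ _ (p * (L / N%:R ^+ 2))).
    by apply: ler_wpM2r => //; rewrite divr_ge0// exprn_ge0.
  by apply: ler_wpM2l => //; exact: ltW.
(* [n.+1^(2/3) <= p + 1] *)
apply: (@le_trans _ _ (Q / (p + 1))); last first.
  by apply: ler_wpM2l => //; rewrite lef_pV2// posrE; lra.
rewrite mulrDr; apply: (@le_trans _ _ ((1 - 2 / p) * (Q / p) + p * (16 * L / p ^+ 3)
   + (2 / p) ^+ 2 * sig2)).
  by rewrite lerD2r; apply: lerD.
rewrite (_ : _ + _ = (Q * (p - 2) + (4 * sig2 + 16 * L)) / p ^+ 2); last by field.
rewrite ler_pdivlMr; last by lra.
rewrite mulrAC ler_pdivrMr ?exprn_gt0//.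
have : (Q * (p - 2) + (4 * sig2 + 16 * L)) * (p + 1) <= (Q * (p - 1)) * (p + 1).
  by apply: ler_wpM2r; lra.
move=> /le_trans; apply; nra.
Qed.

(** Induction on [N]: with [a^3 = N] and [b^3 = N + 1], the increment [3 (b^2 - a^2)]
    exceeds [1 / b]. *)
Lemma sum_inv_cbrt (N : nat) :
  \sum_(t < N) ((t + 5)%:R `^ (1 / 3) : R)^-1 <= 3 * (N%:R `^ (1 / 3)) ^+ 2.
Proof.
elim: N => [|N IH]; first by rewrite big_ord0 mulr_ge0 ?sqr_ge0.
rewrite big_ord_recr/=.
have b0 : 0 < N.+1%:R `^ (1 / 3) :> R by exact: cbrt_gt0.
have a0 := cbrt_ge0 N.
have ab := cbrt_le (leqnSn N).
have b3 : (N.+1%:R `^ (1 / 3) : R) ^+ 3 = (N%:R `^ (1 / 3)) ^+ 3 + 1.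
  by rewrite !cbrt_cube -natr1.
have le5 : ((N + 5)%:R `^ (1 / 3) : R)^-1 <= (N.+1%:R `^ (1 / 3))^-1.
  by rewrite lef_pV2 ?posrE ?cbrt_gt0 ?addn_gt0 ?orbT//; apply: cbrt_le; rewrite -addn1 leq_add2l.
move: IH b0 a0 ab b3 le5.
set a := N%:R `^ _; set b := N.+1%:R `^ _ => IH b0 a0 ab b3 le5.
apply: le_trans (lerD IH le5) _.
rewrite -lerBrDl -mulrBr -(ler_pM2l b0) mulfV ?lt0r_neq0//.
have : 0 <= (b - a) * (2 * b ^+ 2 + (b - a) * a + a * b).
  by rewrite mulr_ge0 ?subr_ge0// !addr_ge0 ?mulr_ge0 ?subr_ge0 ?sqr_ge0// ltW.
have -> : b * (3 * (b ^+ 2 - a ^+ 2))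
    = b ^+ 3 - a ^+ 3 + (b - a) * (2 * b ^+ 2 + (b - a) * a + a * b) by ring.
by rewrite b3; lra.
Qed.

Lemma pow_one_minus_inv (N : nat) : (0 < N)%N ->
  (1 - N%:R^-1 : R) ^+ N <= 1 / expR 1.
Proof.
move=> N0; have N0R : 0 < N%:R :> R by rewrite ltr0n.
have -> : 1 / expR 1 = expR (- N%:R^-1) ^+ N :> R.
  by rewrite -expRM_natl mulrN mulfV ?lt0r_neq0// expRN div1r.
rewrite lerXn2r ?nnegrE ?expR_ge0 ?expR_ge1Dx//.
by rewrite subr_ge0 invf_le1// ler1n.
Qed.

Lemma contraction_unroll (q : R) (a b : nat -> R) (N : nat) : 0 <= q <= 1 ->
  (forall t, (t < N)%N -> 0 <= b t) ->
  (forall t, (t < N)%N -> a t.+1 <= q * a t + b t) ->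
  a N <= q ^+ N * a 0%N + \sum_(t < N) b t.
Proof.
move=> /andP[q0 q1]; elim: N => [|N IH] b0 rec.
  by rewrite big_ord0 expr0 mul1r addr0.
rewrite big_ord_recr/= exprS; apply: le_trans (rec N (ltnSn N)) _.
rewrite addrA lerD2r.
have /(ler_wpM2l q0) := IH (fun t tN => b0 t (leqW tN)) (fun t tN => rec t (leqW tN)).
move=> /le_trans; apply; rewrite mulrDr mulrA lerD2l ler_piMl//.
by apply: sumr_ge0 => t _; apply: b0; apply: leqW.
Qed.

End Numeric.

(** * Moments of the uniform law on the sphere *)

Section Sphere.
Context {R : realType} {Omega : finType}.
Local Notation V := (vec R Omega).
Local Notation full := (@measurable _ V).

Lemma measurable_coordinate k : measurable_fun setT (fun x : V => x k).
Proof.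
move=> _ B mB; rewrite setTI; apply: sub_sigma_algebra.
by exists k, B.
Qed.

Lemma measurable_vec d (T : measurableType d) (U : T -> V) :
  (forall k, measurable_fun setT (fun w => U w k)) -> measurable_fun setT U.
Proof.
move=> mU; apply: (@measurability _ _ T V setT U (@coordinate_cylinders R Omega)) => //.
move=> _ [_ [k [B [mB ->]]] <-].
by rewrite setTI; have := mU k measurableT B mB; rewrite setTI.
Qed.

Lemma sphere_coordinate_le1 (x : Omega -> R) k : dotp x x = 1 -> `|x k| <= 1.
Proof.
move=> x1; rewrite -(@ler_pXn2r _ 2)// ?nnegrE// expr1n real_normK ?num_real// -x1.
by rewrite /dotp (bigD1 k)//= -expr2 lerDl sumr_ge0// => i _; rewrite -expr2 sqr_ge0.
Qed.

Variable mu : probability V R.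
Hypothesis unif : uniform_sphere mu.

Lemma sphere_ae : {ae mu, forall x : V, dotp x x = 1}.
Proof.
pose S := [set x : V | dotp x x = 1].
have mS : measurable S.
  have mD : measurable_fun setT (fun x : V => dotp x x).
    by apply: measurable_sum => k; apply: measurable_funM; exact: measurable_coordinate.
  have -> : S = (fun x : V => dotp x x) @^-1` [set 1] by apply/seteqP; split.
  by rewrite -[X in measurable X]setTI; apply: mD.
have ES : [set x | l2norm x = 1] = S.
  apply/seteqP; split => x /=; rewrite /l2norm /S /=.
    by move=> h; rewrite -[LHS]sqr_sqrtr ?dotp_ge0// h expr1n.
  by move=> ->; rewrite sqrtr1.
exists (~` S); split => //.
- exact: measurableC.
- by rewrite probability_setC// -ES unif.1 subee.
Qed.

Lemma sphere_nonempty : (0 < #|Omega|)%N.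
Proof.
rewrite lt0n; apply/negP => /eqP O0.
have := unif.1; rewrite (_ : [set x | _] = set0).
  by rewrite measure0 => /eqP; rewrite eq_sym onee_eq0.
apply/seteqP; split => // x /=; rewrite /l2norm /dotp big1 ?sqrtr0.
  by move=> /eqP; rewrite eq_sym oner_eq0.
by move=> k _; have := card0_eq O0 k; rewrite inE.
Qed.

Lemma sphere_bddrv k : bddrv mu full (fun x : V => x k).
Proof.
split; first by apply/meas_wrt_full; exact: measurable_coordinate.
by exists 1; apply: filterS sphere_ae => x; exact: sphere_coordinate_le1.
Qed.

Definition mono (A : {set Omega}) (x : Omega -> R) : R := \prod_(i in A) x i.

Lemma mono_bddrv A : bddrv mu full (mono A).
Proof. by apply: bddrv_prod => k _; exact: sphere_bddrv. Qed.

Lemma sphere_invariant q (phi : V -> R) : orthogonal_mx q ->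
  bddrv mu full phi -> Ex mu (fun x => phi (mx_apply q x)) = Ex mu phi.
Proof.
move=> oq bphi.
have mq : measurable_fun setT (mx_apply q : V -> V).
  apply: measurable_vec => k; rewrite /mx_apply.
  by apply: measurable_sum => i; apply: measurable_funM => //; exact: measurable_coordinate.
have := @same_law_Ex R _ _ V V mu mu (mx_apply q) mq (unif.2 _ oq) phi bphi.
by [].
Qed.

Lemma flipE (E : {set Omega}) (x : Omega -> R) :
  mx_apply (fun i j => (i == j)%:R * (-1) ^+ (j \in E)) x = flip E x.
Proof.
apply/funext => i; rewrite /mx_apply /dotp (bigD1 i)//= eqxx mul1r big1 ?addr0//.
by move=> j /negbTE ji; rewrite eq_sym ji !mul0r.
Qed.

Lemma orthogonal_flip (E : {set Omega}) :
  orthogonal_mx (fun i j => (i == j)%:R * (-1) ^+ (j \in E) : R).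
Proof.
move=> i j; rewrite /dotp (bigD1 i)//= eqxx mul1r big1 ?addr0.
  case: eqP => [->|/eqP/negbTE ij]; last by rewrite eq_sym ij mul0r mulr0.
  by rewrite eqxx mul1r -expr2 sqrr_sign.
by move=> l /negbTE li; rewrite eq_sym li !mul0r.
Qed.

Lemma orthogonal_perm (s : {perm Omega}) :
  orthogonal_mx (fun i j => (s i == j)%:R : R).
Proof.
move=> i j; rewrite /dotp (bigD1 (s i))//= eqxx mul1r big1 ?addr0.
  by rewrite (inj_eq perm_inj) eq_sym.
by move=> l /negbTE li; rewrite eq_sym li !mul0r.
Qed.

(** A sign flip of a coordinate in exactly one of [A] and [B] changes the sign of
    the product, but not its mean. *)
Lemma sphere_mono_orth A B : A != B -> Ex mu (fun x => mono A x * mono B x) = 0.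
Proof.
move=> AB.
have [i iAB] : exists i, (i \in A) != (i \in B).
  apply/existsP; apply: contraT; rewrite negb_exists => /forallP h.
  by case/eqP: AB; apply/setP => i; apply/eqP; have := h i; rewrite negbK.
have bAB := bddrvM (mono_bddrv A) (mono_bddrv B).
have chi1 (C : {set Omega}) : chi C [set i]%SET = (-1) ^+ (i \in C) :> R.
  rewrite /chi; case: (boolP (i \in C)) => iC.
    rewrite (bigD1 i)//= big1 ?mulr1 ?inE ?eqxx//.
    by move=> j /andP[_ /negbTE ji]; rewrite inE ji.
  by rewrite big1// => j jC; rewrite inE; case: eqP jC => // ->; rewrite (negbTE iC).
have := sphere_invariant (orthogonal_flip [set i]%SET) bAB.
have -> : (fun x : V => mono A (mx_apply (fun i0 j => (i0 == j)%:R * (-1) ^+ (j \in [set i]%SET)) x)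
    * mono B (mx_apply (fun i0 j => (i0 == j)%:R * (-1) ^+ (j \in [set i]%SET)) x))
  = (fun x => (-1) * (mono A x * mono B x)).
  apply/funext => x; rewrite !flipE /mono !prod_flip !chi1 -!/(mono _ _).
  by case: (i \in A) iAB; case: (i \in B) => // _; rewrite expr0 expr1; ring.
by rewrite ExZ// mulN1r; lra.
Qed.

(** Transpositions make all coordinates equally distributed, and their squares add
    up to [1]. *)
Lemma sphere_coordinate_sqr k : Ex mu (fun x => x k ^+ 2) = #|Omega|%:R^-1.
Proof.
have bk i := bddrvX 2 (sphere_bddrv i).
have same i : Ex mu (fun x => x i ^+ 2) = Ex mu (fun x => x k ^+ 2).
  rewrite -(sphere_invariant (orthogonal_perm (tperm k i)) (bk k)).
  congr (Ex mu _); apply/funext => x; congr (_ ^+ 2).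
  rewrite /mx_apply /dotp tpermL (bigD1 i)//= eqxx mul1r big1 ?addr0//.
  by move=> j /negbTE ji; rewrite eq_sym ji mul0r.
have := Ex_sum (index_enum Omega) (p := xpredT) (fun i _ => bk i).
under eq_bigr do rewrite same.
rewrite sumr_const -[_ *+ _]mulr_natl.
rewrite (@Ex_ae _ _ _ mu _ (fun=> 1)); last first.
- by apply: filterS sphere_ae => x <-; apply: eq_bigr => i _; rewrite expr2.
- exact: bddrv_cst.
- by apply: bddrv_sum.
rewrite Ex_cst => h.
have d0 : #|Omega|%:R != 0 :> R by rewrite pnatr_eq0 -lt0n sphere_nonempty.
by apply: (mulfI d0); rewrite -h mulfV.
Qed.

End Sphere.

(** * Conditional law of the directions *)

Section Directions.
Context {R : realType} {Omega : finType} {d : measure_display} {T : measurableType d}.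
Local Notation V := (vec R Omega).
Local Notation full := (@measurable d T).
Local Notation fullV := (@measurable _ V).
Variables (P : probability T R) (mu : probability V R) (G : set (set T)) (b : nat).
Variable u : nat -> T -> Omega -> R.
Hypothesis sG : Defs.sub_sigma_algebra G.
Hypothesis mu_ : forall i, (i < b)%N -> forall A : set V, measurable A ->
  measurable (u i @^-1` A).
Hypothesis law : forall H, G H ->
  forall A : nat -> set V, (forall i, measurable (A i)) ->
      P (H `&` [set w | forall i, (i < b)%N -> A i (u i w)]) =
      (P H * \prod_(i < b) mu (A i))%E.

Let GT : G setT.
Proof.
have [[G0 GC _] _] := sG; rewrite -[setT]setD0; exact: GC.
Qed.

Lemma direction_pair_law (i j : 'I_b) H (A B : set V) : i != j -> G H ->
  measurable A -> measurable B ->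
  P (H `&` (u i @^-1` A `&` u j @^-1` B)) = (P H * (mu A * mu B))%E.
Proof.
move=> ij GH mA mB.
pose C (n : nat) : set V := if n == i :> nat then A else if n == j :> nat then B else setT.
have := law GH (A := C) _.
rewrite (bigD1 i)//= (bigD1 j)/=; last by rewrite eq_sym.
have ji : (j == i :> nat) = false by apply/negbTE; rewrite eq_sym.
rewrite big1 ?mule1; last first.
  move=> n /andP[ni nj]; rewrite /C.
  by rewrite (negbTE (ni : n != i :> nat)) (negbTE (nj : n != j :> nat)) probability_setT.
rewrite /C ji !eqxx => <-.
  congr (P (_ `&` _)); apply/seteqP; split => w /=.
    move=> [Aw Bw] n nb; case: ifP => [/eqP ->//|_].
    by case: ifP => [/eqP ->//|].
  move=> h; split.
    by have := h i (ltn_ord i); rewrite eqxx.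
  by have := h j (ltn_ord j); rewrite ji eqxx.
by move=> n; case: ifP => // _; case: ifP.
Qed.

Lemma direction_single_law (i : 'I_b) H (A : set V) : G H -> measurable A ->
  P (H `&` u i @^-1` A) = (P H * mu A)%E.
Proof.
move=> GH mA.
pose C (n : nat) : set V := if n == i :> nat then A else setT.
have := law GH (A := C) _.
rewrite (bigD1 i)//= big1 ?mule1; last first.
  by move=> n ni; rewrite /C (negbTE (ni : n != i :> nat)) probability_setT.
rewrite /C !eqxx => <-.
  congr (P (_ `&` _)); apply/seteqP; split => w /=.
    by move=> Aw n nb; case: ifP => [/eqP ->//|].
  by move=> h; have := h i (ltn_ord i); rewrite eqxx.
by move=> n; case: ifP.
Qed.

Lemma direction_law1 (i : 'I_b) (A : set V) : measurable A -> P (u i @^-1` A) = mu A.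
Proof.
move=> mA; have := direction_single_law i GT mA.
by rewrite setTI [P setT](probability_setT P) mul1e.
Qed.

Lemma measurable_direction (i : 'I_b) : measurable_fun setT (u i : T -> V).
Proof. by move=> _ A mA; rewrite setTI; apply: mu_. Qed.

Lemma direction_cond1 (i : 'I_b) phi : bddrv mu fullV phi ->
  condeq P G (fun w => phi (u i w)) (fun=> Ex mu phi).
Proof.
move=> bphi; have mUi := measurable_direction i; have lawi := direction_law1 i.
have bU := same_law_bddrv mUi lawi (measurable_preimage mUi) bphi.
apply: condeq_of_sets => //; first exact: bddrv_cst.
move=> H GH; have mH : measurable H by case: sG => _; apply.
under eq_fun do rewrite mulrC.
rewrite (@indep_Ex _ _ _ _ _ P mu (u i) mUi \1_H (fine (P H)) phi)//.
- by rewrite -Ex_indic// mulrC -ExZ ?Ex_indic//; [congr Ex; apply/funext => w; rewrite mulrC|exact: bddrv_indic].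
- exact: bddrv_indic.
- move=> A mA; rewrite -fineM ?fin_num_measure// -(direction_single_law i)//.
  rewrite -Ex_indic; last by apply: measurableI => //; exact: (measurable_preimage mUi).
  by congr Ex; apply/funext => w; rewrite setIC indicI.
Qed.

(** Two applications of [indep_Ex], first to [u i] with the event for [u j] frozen,
    then to [u j] with the function of [u i] frozen. *)
Lemma direction_cond2 (i j : 'I_b) phi psi : i != j ->
  bddrv mu fullV phi -> bddrv mu fullV psi ->
  condeq P G (fun w => phi (u i w) * psi (u j w)) (fun=> Ex mu phi * Ex mu psi).
Proof.
move=> ij bphi bpsi.
have mUi := measurable_direction i; have lawi := direction_law1 i.
have mUj := measurable_direction j; have lawj := direction_law1 j.
have bUi := same_law_bddrv mUi lawi (measurable_preimage mUi) bphi.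
have bUj := same_law_bddrv mUj lawj (measurable_preimage mUj) bpsi.
apply: condeq_of_sets => //; [exact: bddrvM|exact: bddrv_cst|].
move=> H GH; have mH : measurable H by case: sG => _; apply.
have bH : bddrv P full (\1_H) by exact: bddrv_indic.
rewrite (_ : (fun w => _) = (fun w => psi (u j w) * (phi (u i w) * \1_H w))); last first.
  by apply/funext => w; ring.
rewrite (@indep_Ex _ _ _ _ _ P mu (u j) mUj _ (fine (P H) * Ex mu phi) psi)//.
- rewrite [RHS](_ : _ = Ex P (fun w => Ex mu phi * Ex mu psi * \1_H w)).
    by rewrite ExZ// Ex_indic//; ring.
  by congr Ex; apply/funext => w; rewrite mulrC.
- exact: bddrvM.
- move=> B mB.
  have bB : bddrv P full (\1_(u j @^-1` B)) by apply/bddrv_indic/(measurable_preimage mUj).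
  rewrite (_ : (fun w => _) = (fun w => phi (u i w) * (\1_(u j @^-1` B) w * \1_H w))); last first.
    by apply/funext => w; ring.
  rewrite (@indep_Ex _ _ _ _ _ P mu (u i) mUi _ (fine (P H) * fine (mu B)) phi)//.
  + by ring.
  + exact: bddrvM.
  + move=> A mA.
    transitivity (fine (P (H `&` (u i @^-1` A `&` u j @^-1` B)))).
      rewrite -Ex_indic; last first.
        by apply: measurableI => //; apply: measurableI;
          [exact: (measurable_preimage mUi)|exact: (measurable_preimage mUj)].
      by congr Ex; apply/funext => w; rewrite !indicI/=; ring.
    rewrite direction_pair_law// !fineM ?fin_numM ?fin_num_measure//; ring.
Qed.

End Directions.

(** * Conditional law of the sampled sets *)

Section Draws.
Context {R : realType} {Omega : finType} {d : measure_display} {T : measurableType d}.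
Local Notation full := (@measurable d T).
Local Notation F := multilinear_ext.
Variables (P : probability T R) (G : set (set T)) (b l : nat).
Variable q : nat -> bool -> T -> Omega -> R.
Variable Y : nat -> bool -> nat -> T -> {set Omega}.
Hypothesis sG : Defs.sub_sigma_algebra G.
Hypothesis bq : forall i s k, (i < b)%N -> bddrv P G (fun w => q i s w k).
Hypothesis mY : forall i s j, (i < b)%N -> (j < l)%N -> forall A,
  measurable [set w | Y i s j w = A].
Hypothesis law : forall H, G H -> forall a : nat -> bool -> nat -> {set Omega},
  P (H `&` [set w | forall i s j, (i < b)%N -> (j < l)%N -> Y i s j w = a i s j]) =
  (\int[P]_(w in H)
     (\prod_(i < b) \prod_(s : bool) \prod_(j < l)
        sample_prob (q i s w) (a i s j))%:E)%E.

Local Notation J := ('I_b * bool * 'I_l)%type.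
Let YJ (x : J) := Y x.1.1 x.1.2 x.2.
Let qJ (x : J) := q x.1.1 x.1.2.

Let Gfull : G `<=` full := sG.2.

Lemma bddrv_sample_prob (x : J) S : bddrv P G (fun w => sample_prob (qJ x w) S).
Proof.
apply: bddrvM; apply: bddrv_prod => k _; first exact: bq.
by apply: bddrvB; [exact: bddrv_cst|exact: bq].
Qed.

Lemma bddrv_multilinear_ext (x : J) phi : bddrv P G (fun w => F phi (qJ x w)).
Proof.
by apply: bddrv_sum => S _; apply: bddrvZ; exact: bddrv_sample_prob.
Qed.

Lemma bddrv_draw (x : J) (phi : {set Omega} -> R) :
  bddrv P full (fun w => phi (YJ x w)).
Proof. by apply: bddrv_discrete => A; apply: mY. Qed.

(** Both sides are expanded over all possible outcomes of the draws. *)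
Lemma draw_cond (phi : J -> {set Omega} -> R) :
  condeq P G (fun w => \prod_x phi x (YJ x w)) (fun w => \prod_x F (phi x) (qJ x w)).
Proof.
pose E (a : {ffun J -> {set Omega}}) := [set w | forall x, YJ x w = a x].
have mE a : measurable (E a).
  have -> : E a = \bigcap_(x in [set: J]) [set w | YJ x w = a x].
    by apply/seteqP; split => w /= h x; [move=> _|]; apply: h.
  apply: fin_bigcap_measurable; first exact: finite_finset.
  by move=> x _; apply: mY.
apply: (@condeq_eq _ _ _ _ _ (fun w => \sum_(a : {ffun J -> {set Omega}}) (\prod_x phi x (a x)) * \1_(E a) w)
  _ (fun w => \sum_(a : {ffun J -> {set Omega}}) (\prod_x phi x (a x)) * \prod_x sample_prob (qJ x w) (a x))).
- move=> w; rewrite (bigD1 [ffun x => YJ x w])//= indicE mem_set ?mulr1; last first.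
    by move=> x; rewrite ffunE.
  rewrite [X in _ + X]big1 ?addr0; first by apply: eq_bigr => x _; rewrite ffunE.
  move=> a aY; rewrite indicE memNset ?mulr0// => h; case/eqP: aY.
  by apply/ffunP => x; rewrite ffunE h.
- move=> w; rewrite /F bigA_distr_bigA/=; apply: eq_bigr => a _.
  by rewrite -big_split.
have bsp (a : {ffun J -> {set Omega}}) :
    bddrv P G (fun w => \prod_x sample_prob (qJ x w) (a x)).
  by apply: bddrv_prod => x _; exact: bddrv_sample_prob.
have bspf a := bddrv_sub Gfull (bsp a).
have bEa a : bddrv P full (\1_(E a)) by exact: bddrv_indic.
apply: condeq_sum => //; [by move=> a _; apply: bddrvZ..|move=> a _].
apply: condeqZ; apply: condeq_of_sets => // H GH.
have mH : measurable H by exact: Gfull.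
(* outcomes outside the index range get the default value [set0] *)
pose a' i s j : {set Omega} := if insub i is Some i' then
   if insub j is Some j' then a (i', s, j') else finset.set0 else finset.set0.
have a'E (i : 'I_b) s (j : 'I_l) : a' i s j = a (i, s, j).
  by rewrite /a' !insubT//= => h1 h2; congr (a (_, _, _)); apply/val_inj.
have := law GH a'.
rewrite (_ : H `&` _ = H `&` E a); last first.
  congr (_ `&` _); apply/seteqP; split => w /= h.
    by move=> [[i s] j]; rewrite -a'E; apply: h.
  move=> i s j ib jl; have := h (Ordinal ib, s, Ordinal jl).
  by rewrite -a'E.
rewrite (_ : (fun w => (\prod_(i < b) _)%:E) =
    (fun w => (\prod_x sample_prob (qJ x w) (a x))%:E)); last first.
  apply/funext => w; congr (_%:E).
  rewrite pair_big pair_big/=; apply: eq_bigr => -[[i s] j] _ /=.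
  by rewrite a'E.
rewrite (Ex_indicM P H (fun w => \prod_x sample_prob (qJ x w) (a x))) /Rintegral => <-.
rewrite -Ex_indic; last exact: measurableI.
by congr Ex; apply/funext => w; rewrite indicI.
Qed.

Lemma draw_cond1 (x : J) phi :
  condeq P G (fun w => phi (YJ x w)) (fun w => F phi (qJ x w)).
Proof.
apply: condeq_eq (draw_cond (fun y => if y == x then phi else fun=> 1)) => w.
  rewrite (bigD1 x)//= eqxx big1 ?mulr1// => y /negbTE yx.
  by rewrite yx.
rewrite (bigD1 x)//= eqxx big1 ?mulr1// => y /negbTE yx.
by rewrite yx multilinear_ext_cst.
Qed.

Lemma draw_cond2 (x y : J) phi psi : x != y ->
  condeq P G (fun w => phi (YJ x w) * psi (YJ y w))
             (fun w => F phi (qJ x w) * F psi (qJ y w)).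
Proof.
move=> xy.
apply: condeq_eq (draw_cond
  (fun z => if z == x then phi else if z == y then psi else fun=> 1)) => w.
  rewrite (bigD1 x)//= (bigD1 y)/=; last by rewrite eq_sym.
  rewrite eqxx eq_sym (negbTE xy) eqxx big1 ?mulr1// => z /andP[/negbTE zx /negbTE zy].
  by rewrite zx zy.
rewrite (bigD1 x)//= (bigD1 y)/=; last by rewrite eq_sym.
rewrite eqxx eq_sym (negbTE xy) eqxx big1 ?mulr1// => z /andP[/negbTE zx /negbTE zy].
by rewrite zx zy multilinear_ext_cst.
Qed.

Variable f : {set Omega} -> R.

Definition sample_diff (i : nat) (w : T) : R :=
  sample_mean f l (fun j => Y i false j w) - sample_mean f l (fun j => Y i true j w).

Definition mean_diff (i : nat) (w : T) : R := F f (q i false w) - F f (q i true w).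

Let X (x : 'I_b * 'I_l) w : R := f (Y x.1 false x.2 w) - f (Y x.1 true x.2 w).

Let bX x : bddrv P full (X x).
Proof.
case: x => i j; apply: bddrvB.
  exact: (bddrv_draw (i, false, j)).
exact: (bddrv_draw (i, true, j)).
Qed.

Lemma bddrv_mean_diff (i : 'I_b) : bddrv P G (mean_diff i).
Proof.
case: (pickP 'I_l) => [j _|l0].
  apply: bddrvB; first exact: (bddrv_multilinear_ext (i, false, j)).
  exact: (bddrv_multilinear_ext (i, true, j)).
by apply: bddrvB; apply: bddrv_sum => S _; apply: bddrvZ; apply: bddrvM;
   apply: bddrv_prod => k _; try exact: bq; apply: bddrvB;
   (exact: bddrv_cst || exact: bq).
Qed.

Lemma sample_diffE (i : 'I_b) w : sample_diff i w = l%:R^-1 * \sum_j X (i, j) w.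
Proof. by rewrite /sample_diff /sample_mean -mulrBr -sumrB. Qed.

Lemma bddrv_sample_diff (i : 'I_b) : bddrv P full (sample_diff i).
Proof.
rewrite (_ : sample_diff i = fun w => l%:R^-1 * \sum_j X (i, j) w).
  by apply: bddrvZ; apply: bddrv_sum.
by apply/funext => w; exact: sample_diffE.
Qed.

Let X_cond1 x : condeq P G (X x) (mean_diff x.1).
Proof.
case: x => i j; apply: condeqB => //.
- exact: (bddrv_draw (i, false, j)).
- exact: (bddrv_draw (i, true, j)).
- exact: (bddrv_sub Gfull (bddrv_multilinear_ext (i, false, j) f)).
- exact: (bddrv_sub Gfull (bddrv_multilinear_ext (i, true, j) f)).
- exact: (draw_cond1 (i, false, j) f).
- exact: (draw_cond1 (i, true, j) f).
Qed.

Let X_cond2 x y : x != y ->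
  condeq P G (fun w => X x w * X y w) (fun w => mean_diff x.1 w * mean_diff y.1 w).
Proof.
case: x y => [i j] [i' j'] xy.
have e s s' : (i, s, j) != (i', s', j') :> J.
  by apply: contra xy => /eqP[-> _ ->].
have bd s : bddrv P full (fun w => f (Y i s j w)) by exact: (bddrv_draw (i, s, j)).
have bd' s : bddrv P full (fun w => f (Y i' s j' w)) by exact: (bddrv_draw (i', s, j')).
have bF s := bddrv_sub Gfull (bddrv_multilinear_ext (i, s, j) f).
have bF' s := bddrv_sub Gfull (bddrv_multilinear_ext (i', s, j') f).
have c s s' := draw_cond2 f f (e s s').
have bb s s' := bddrvM (bd s) (bd' s').
have bbF s s' := bddrvM (bF s) (bF' s').
have h := condeqB Gfull
  (bddrvB (bb false false) (bb false true)) (bddrvB (bb true false) (bb true true))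
  (bddrvB (bbF false false) (bbF false true)) (bddrvB (bbF true false) (bbF true true))
  (condeqB Gfull (bb _ _) (bb _ _) (bbF _ _) (bbF _ _) (c false false) (c false true))
  (condeqB Gfull (bb _ _) (bb _ _) (bbF _ _) (bbF _ _) (c true false) (c true true)).
apply: condeq_eq h => w; rewrite /X /mean_diff /=; ring.
Qed.

Lemma sample_diff_cond1 (i : 'I_b) : (0 < l)%N ->
  condeq P G (sample_diff i) (mean_diff i).
Proof.
move=> l0; have ln0 : l%:R != 0 :> R by rewrite pnatr_eq0 -lt0n.
have bm := bddrv_sub Gfull (bddrv_mean_diff i).
have h := condeqZ l%:R^-1 (condeq_sum (index_enum 'I_l) (p := xpredT) Gfull
  (fun j _ => bX (i, j)) (fun j _ => bm) (fun j _ => @X_cond1 (i, j))).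
apply: condeq_eq h => w; first by rewrite sample_diffE.
by rewrite sumr_const card_ord -[mean_diff i w *+ l]mulr_natl mulrA mulVf// mul1r.
Qed.

Lemma sample_diff_cond2 (i i' : 'I_b) : (0 < l)%N -> i != i' ->
  condeq P G (fun w => sample_diff i w * sample_diff i' w)
             (fun w => mean_diff i w * mean_diff i' w).
Proof.
move=> l0 ii'; have ln0 : l%:R != 0 :> R by rewrite pnatr_eq0 -lt0n.
have bm := bddrvM (bddrv_sub Gfull (bddrv_mean_diff i)) (bddrv_sub Gfull (bddrv_mean_diff i')).
have ne (j j' : 'I_l) : (i, j) != (i', j') by apply: contra ii' => /eqP[->].
have h1 j := condeq_sum (index_enum 'I_l) (p := xpredT) Gfull
  (fun j' _ => bddrvM (bX (i, j)) (bX (i', j'))) (fun j' _ => bm)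
  (fun j' _ => X_cond2 (ne j j')).
have h := condeqZ (l%:R^-1 * l%:R^-1) (condeq_sum (index_enum 'I_l) (p := xpredT) Gfull
  (fun j _ => bddrv_sum _ (fun j' _ => bddrvM (bX (i, j)) (bX (i', j'))))
  (fun j _ => bddrv_sum _ (fun j' _ => bm))
  (fun j _ => h1 j)).
apply: condeq_eq h => w.
  rewrite !sample_diffE mulrACA; congr (_ * _).
  by rewrite mulr_suml; apply: eq_bigr => j _; rewrite mulr_sumr.
rewrite !sumr_const card_ord; set m := mean_diff i w * _.
by rewrite -mulrnA -[m *+ _]mulr_natl natrM; field.
Qed.

(** Only the [l] diagonal terms of the square of the sample mean see the variance
    of the draws, at most [M^2] for each sign. *)
Lemma sample_diff_sqr (i : 'I_b) (M : R) : (0 < l)%N ->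
  (forall A, 0 <= f A <= M) ->
  (forall s, {ae P, forall w, in_cube (q i s w)}) ->
  Ex P (fun w => sample_diff i w ^+ 2)
    <= Ex P (fun w => mean_diff i w ^+ 2) + 2 * M ^+ 2 / l%:R.
Proof.
move=> l0 fM qc; have l0R : 0 < l%:R :> R by rewrite ltr0n.
have bm := bddrv_sub Gfull (bddrv_mean_diff i).
have bm2 := bddrvX 2 bm.
have XX j j' : Ex P (fun w => X (i, j) w * X (i, j') w)
    <= Ex P (fun w => mean_diff i w ^+ 2) + (j == j')%:R * (2 * M ^+ 2).
  have [<-|jj'] := eqVneq j j'; last first.
    rewrite mul0r addr0 (condeq_Ex (@X_cond2 (i, j) (i, j') _)) /=.
      by under eq_fun do rewrite -expr2.
    by apply: contra jj' => /eqP[->].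
  rewrite mul1r -[X in _ + X](Ex_cst P) -ExD//; last exact: bddrv_cst.
  have ne : (i, false, j) != (i, true, j) :> J by apply/eqP; case.
  have bd s : bddrv P full (fun w => f (Y i s j w)) by exact: (bddrv_draw (i, s, j)).
  have bd2 s : bddrv P full (fun w => f (Y i s j w) ^+ 2).
    exact: (bddrv_draw (i, s, j) (fun A => f A ^+ 2)).
  have bF s := bddrv_sub Gfull (bddrv_multilinear_ext (i, s, j) f).
  have bF2 s := bddrv_sub Gfull (bddrv_multilinear_ext (i, s, j) (fun A => f A ^+ 2)).
  have -> : Ex P (fun w => X (i, j) w * X (i, j) w)
      = Ex P (fun w => F (fun A => f A ^+ 2) (q i false w) + F (fun A => f A ^+ 2) (q i true w)
           - 2 * (F f (q i false w) * F f (q i true w))).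
    apply: (@condeq_Ex _ _ _ _ G).
    have h := condeqB Gfull (bddrvD (bd2 false) (bd2 true))
      (bddrvZ 2 (bddrvM (bd false) (bd true)))
      (bddrvD (bF2 false) (bF2 true)) (bddrvZ 2 (bddrvM (bF false) (bF true)))
      (condeqD Gfull (bd2 _) (bd2 _) (bF2 _) (bF2 _)
        (draw_cond1 (i, false, j) (fun A => f A ^+ 2))
        (draw_cond1 (i, true, j) (fun A => f A ^+ 2)))
      (condeqZ 2 (draw_cond2 f f ne)).
    by apply: condeq_eq h => w; rewrite /X /=; ring.
  apply: Ex_le.
  - exact: (bddrvB (bddrvD (bF2 false) (bF2 true)) (bddrvZ 2 (bddrvM (bF false) (bF true)))).
  - by apply: bddrvD => //; exact: bddrv_cst.
  - apply: filterS2 (qc false) (qc true) => w c1 c2.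
    have f2 A : f A ^+ 2 <= M ^+ 2.
      have /andP[f0 f1] := fM A.
      by rewrite ler_sqr ?nnegrE//; exact: le_trans f1.
    have h1 := le_multilinear_ext c1 f2; have h2 := le_multilinear_ext c2 f2.
    rewrite !multilinear_ext_cst in h1 h2.
    by rewrite /mean_diff; nra.
have -> : Ex P (fun w => sample_diff i w ^+ 2)
    = (l%:R^-1) ^+ 2 * \sum_j \sum_j' Ex P (fun w => X (i, j) w * X (i, j') w).
  transitivity (Ex P (fun w => (l%:R^-1) ^+ 2 * \sum_j \sum_j' (X (i, j) w * X (i, j') w))).
    congr Ex; apply/funext => w; rewrite sample_diffE exprMn; congr (_ * _).
    by rewrite expr2 mulr_suml; apply: eq_bigr => j _; rewrite mulr_sumr.
  rewrite ExZ; last by do 2 (apply: bddrv_sum => ? _); exact: bddrvM.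
  congr (_ * _); rewrite Ex_sum; last by move=> j _; apply: bddrv_sum => ? _; exact: bddrvM.
  apply: eq_bigr => j _; rewrite Ex_sum// => j' _; exact: bddrvM.
apply: (@le_trans _ _ (l%:R^-1 ^+ 2 * \sum_(j < l) \sum_(j' < l)
   (Ex P (fun w => mean_diff i w ^+ 2) + (j == j')%:R * (2 * M ^+ 2)))).
  apply: ler_wpM2l; first by rewrite sqr_ge0.
  by apply: ler_sum => j _; apply: ler_sum => j' _.
rewrite (eq_bigr (fun=> l%:R * Ex P (fun w => mean_diff i w ^+ 2) + 2 * M ^+ 2)).
  rewrite sumr_const card_ord -[X in _ * X <= _]mulr_natl.
  rewrite le_eqVlt; apply/orP; left; apply/eqP; field.
  by rewrite lt0r_neq0.
move=> j _; rewrite big_split/= sumr_const card_ord -[X in X + _ = _]mulr_natl; congr (_ + _).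
rewrite (bigD1 j)//= eqxx mul1r big1 ?addr0// => j' /negbTE jj'.
by rewrite eq_sym jj' mul0r.
Qed.

End Draws.

(** * The two-point gradient estimate *)

Section Step.
Context {R : realType} {Omega : finType} {d : measure_display} {T : measurableType d}.
Local Notation V := (vec R Omega).
Local Notation full := (@measurable d T).
Local Notation fullV := (@measurable _ V).
Local Notation F := multilinear_ext.
Variables (P : probability T R) (mu : probability V R) (G0 G1 : set (set T)).
Variables (b l : nat) (delta M : R) (f : {set Omega} -> R).
Variables (y : T -> Omega -> R) (u : nat -> T -> Omega -> R).
Variable Y : nat -> bool -> nat -> T -> {set Omega}.
Let q i (s : bool) w k : R := y w k + (-1) ^+ s * delta * u i w k.
Hypothesis unif : uniform_sphere mu.
Hypothesis b0 : (0 < b)%N.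
Hypothesis l0 : (0 < l)%N.
Hypothesis delta0 : 0 < delta.
Hypothesis f_mono : monotone_set_fun f.
Hypothesis f_bounds : forall A, 0 <= f A <= M.
Hypothesis sG0 : Defs.sub_sigma_algebra G0.
Hypothesis sG1 : Defs.sub_sigma_algebra G1.
Hypothesis G01 : G0 `<=` G1.
Hypothesis y_adapted : forall k, bddrv P G0 (fun w => y w k).
Hypothesis y_bounds : forall w k, delta <= y w k <= 1 - delta.
Hypothesis u_adapted : forall i, (i < b)%N ->
  forall A : set V, measurable A -> G1 (u i @^-1` A).
Hypothesis u_law : forall H, G0 H ->
  forall A : nat -> set V, (forall i, measurable (A i)) ->
      P (H `&` [set w | forall i, (i < b)%N -> A i (u i w)]) =
      (P H * \prod_(i < b) mu (A i))%E.
Hypothesis Y_measurable : forall i s j, (i < b)%N -> (j < l)%N -> forall A,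
  measurable [set w | Y i s j w = A].
Hypothesis Y_law : forall H, G1 H -> forall a : nat -> bool -> nat -> {set Omega},
  P (H `&` [set w | forall i s j, (i < b)%N -> (j < l)%N -> Y i s j w = a i s j]) =
  (\int[P]_(w in H)
     (\prod_(i < b) \prod_(s : bool) \prod_(j < l)
        sample_prob (q i s w) (a i s j))%:E)%E.

Let G1full : G1 `<=` full := sG1.2.
Let G0full : G0 `<=` full := sG0.2.
Local Notation dim := (#|Omega|%:R : R).

Let dim0 : 0 < dim.
Proof. by rewrite ltr0n; exact: sphere_nonempty unif. Qed.

Let u_meas i (ib : (i < b)%N) (A : set V) : measurable A -> measurable (u i @^-1` A).
Proof. by move=> mA; apply: G1full; exact: u_adapted. Qed.

Let u_measfun (i : 'I_b) : measurable_fun setT (u i : T -> V).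
Proof. exact: (measurable_direction u_meas). Qed.

Let u_law1 (i : 'I_b) (A : set V) : measurable A -> P (u i @^-1` A) = mu A.
Proof. exact: (direction_law1 sG0 u_law). Qed.

Let u_bddrv (i : 'I_b) phi : bddrv mu fullV phi -> bddrv P G1 (fun w => phi (u i w)).
Proof.
exact: (same_law_bddrv (u_measfun i) (@u_law1 i) (u_adapted (ltn_ord i))).
Qed.

Let u_sphere (i : 'I_b) : {ae P, forall w, dotp (u i w) (u i w) = 1}.
Proof.
exact: (same_law_ae (u_measfun i) (@u_law1 i) (sphere_ae unif)).
Qed.

Let q_bddrv i s k : (i < b)%N -> bddrv P G1 (fun w => q i s w k).
Proof.
move=> ib; apply: bddrvD; first exact: bddrv_sub (y_adapted k).
apply: bddrvZ; exact: (u_bddrv (Ordinal ib) (sphere_bddrv unif k)).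
Qed.

Let q_cube (i : 'I_b) s : {ae P, forall w, in_cube (q i s w)}.
Proof.
apply: filterS (u_sphere i) => w u1 k; rewrite /q.
have := sphere_coordinate_le1 k u1; have /andP[y1 y2] := y_bounds w k.
rewrite ler_norml => /andP[u2 u3].
have := ler_wpM2l (ltW delta0) u2; have := ler_wpM2l (ltW delta0) u3.
rewrite mulrN mulr1 => h1 h2.
by case: s; rewrite -mulrA /= ?expr1 ?expr0 ?mulN1r ?mul1r; apply/andP; split; lra.
Qed.

(* twice [delta^|A|] for odd [#|A|], zero for even [#|A|] *)
Let kappa (A : {set Omega}) : R := delta ^+ #|A| - (- delta) ^+ #|A|.

Let DF := mean_diff q f.

Let DF_expand i w : DF i w = \sum_A coef f (y w) A * kappa A * mono A (u i w).
Proof.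
rewrite /DF /mean_diff /q.
rewrite !multilinear_ext_expand -sumrB; apply: eq_bigr => A _.
rewrite /kappa /mono expr0 expr1 -mulrBr -mulrA; congr (_ * _).
under eq_bigr do rewrite mul1r; under [X in _ - X]eq_bigr do rewrite mulN1r.
by rewrite !big_split/= !prodr_const mulrBl.
Qed.

Let coef_bddrv A : bddrv P G0 (fun w => coef f (y w) A).
Proof.
apply: bddrv_sum => S _; apply: bddrvZ; apply: bddrv_prod => k _.
case: (k \in A); case: (k \in S); try exact: bddrv_cst; first exact: y_adapted.
by apply: bddrvB; [exact: bddrv_cst|exact: y_adapted].
Qed.

Let mono_coord_mean A k :
  Ex mu (fun x => mono A x * x k) = (A == [set k]%SET)%:R / dim.
Proof.
rewrite (_ : (fun x : V => _) = (fun x => mono A x * mono [set k]%SET x)); last first.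
  by apply/funext => x; rewrite /mono big_set1.
have [->|Ak] := eqVneq A [set k]%SET; last by rewrite (sphere_mono_orth unif Ak) mul0r.
rewrite mul1r -(sphere_coordinate_sqr unif k).
by congr Ex; apply/funext => x; rewrite /mono big_set1 expr2.
Qed.

Let kappa1 k : kappa [set k]%SET = 2 * delta.
Proof. by rewrite /kappa cards1 !expr1; ring. Qed.

Let mk_bddrv A k : bddrv mu fullV (fun x => mono A x * x k).
Proof. by apply: bddrvM; [exact: mono_bddrv|exact: sphere_bddrv]. Qed.

Let pick_coef k (g : {set Omega} -> R) :
  \sum_A g A * ((A == [set k]%SET)%:R / dim) = g [set k]%SET / dim.
Proof.
rewrite (bigD1 [set k]%SET)//= eqxx mul1r big1 ?addr0// => A /negbTE ->.
by rewrite mul0r mulr0.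
Qed.

(** The conditional mean of the finite difference times [u k]: its linear term in
    [u k] is [2 delta u_k] times the partial derivative, and [E u_k^2 = 1 / d]. *)
Definition scaled_partial k w : R := 2 * delta / dim * F (setder f k) (y w).

Let scaled_partialE k w : coef f (y w) [set k]%SET * kappa [set k]%SET / dim
   = scaled_partial k w.
Proof. rewrite kappa1 coef1 /scaled_partial; ring. Qed.

(** Of the expansion of the finite difference into monomials, the factor [u k]
    selects the linear one in [k]; no smoothing error arises. *)
Lemma mean_diff_unbiased (i : 'I_b) k :
  condeq P G0 (fun w => DF i w * u i w k) (scaled_partial k).
Proof.
have bc A : bddrv P G0 (fun w => coef f (y w) A * kappa A).
  by apply: bddrvM => //; exact: bddrv_cst.
have bu A := bddrv_sub G1full (u_bddrv i (mk_bddrv A k)).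
have h := condeq_sum (index_enum {set Omega}) (p := xpredT) G0full
  (fun A _ => bddrvM (bddrv_sub G0full (bc A)) (bu A))
  (fun A _ => bddrvM (bddrv_sub G0full (bc A)) (bddrv_cst P full (Ex mu (fun x => mono A x * x k))))
  (fun A _ => condeqM (bc A) (direction_cond1 sG0 u_meas u_law i (mk_bddrv A k))).
apply: condeq_eq h => w.
  rewrite DF_expand mulr_suml; apply: eq_bigr => A _; ring.
under eq_bigr do rewrite mono_coord_mean.
by rewrite pick_coef scaled_partialE.
Qed.

Lemma mean_diff_uncorrelated (i j : 'I_b) k : i != j ->
  condeq P G0 (fun w => (DF i w * u i w k) * (DF j w * u j w k))
              (fun w => scaled_partial k w * scaled_partial k w).
Proof.
move=> ij.
have bc A : bddrv P G0 (fun w => coef f (y w) A * kappa A).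
  by apply: bddrvM => //; exact: bddrv_cst.
have bcc A B := bddrvM (bc A) (bc B).
have bccf A B := bddrv_sub G0full (bcc A B).
have bui A := bddrv_sub G1full (u_bddrv i (mk_bddrv A k)).
have buj A := bddrv_sub G1full (u_bddrv j (mk_bddrv A k)).
have bcst A B := bddrv_cst P full (Ex mu (fun x => mono A x * x k) * Ex mu (fun x => mono B x * x k)).
have h1 A := condeq_sum (index_enum {set Omega}) (p := xpredT) G0full
  (fun B _ => bddrvM (bccf A B) (bddrvM (bui A) (buj B)))
  (fun B _ => bddrvM (bccf A B) (bcst A B))
  (fun B _ => condeqM (bcc A B)
     (direction_cond2 sG0 u_meas u_law ij (mk_bddrv A k) (mk_bddrv B k))).
have h := condeq_sum (index_enum {set Omega}) (p := xpredT) G0full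
  (fun A _ => bddrv_sum _ (fun B _ => bddrvM (bccf A B) (bddrvM (bui A) (buj B))))
  (fun A _ => bddrv_sum _ (fun B _ => bddrvM (bccf A B) (bcst A B)))
  (fun A _ => h1 A).
apply: condeq_eq h => w.
  rewrite !DF_expand !mulr_suml; apply: eq_bigr => A _.
  rewrite mulr_sumr; apply: eq_bigr => B _; ring.
rewrite -scaled_partialE -(pick_coef k (fun A => coef f (y w) A * kappa A)) mulr_suml; apply: eq_bigr => A _.
rewrite mulr_sumr; apply: eq_bigr => B _.
rewrite !mono_coord_mean; ring.
Qed.

(** Orthogonality of the monomials removes the mixed terms. The remaining
    sum is the mean over the sphere, for each fixed centre, of the energy of the odd
    monomials. *)
Lemma mean_diff_sqr (i : 'I_b) :
  Ex P (fun w => DF i w ^+ 2) <= 4 * M ^+ 2 * delta ^+ 2.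
Proof.
have bc A : bddrv P G0 (fun w => coef f (y w) A * kappa A).
  by apply: bddrvM => //; exact: bddrv_cst.
have bcc A B := bddrvM (bc A) (bc B).
have bccf A B := bddrv_sub G0full (bcc A B).
have bmm A B : bddrv mu fullV (fun x => mono A x * mono B x).
  by apply: bddrvM; exact: mono_bddrv.
have bu A B := bddrv_sub G1full (u_bddrv i (bmm A B)).
have -> : Ex P (fun w => DF i w ^+ 2) = Ex P (fun w => \sum_A \sum_B
    (coef f (y w) A * kappa A) * (coef f (y w) B * kappa B)
    * (mono A (u i w) * mono B (u i w))).
  congr Ex; apply/funext => w; rewrite expr2 DF_expand mulr_suml; apply: eq_bigr => A _.
  rewrite mulr_sumr; apply: eq_bigr => B _; ring.
have E A B : Ex P (fun w => (coef f (y w) A * kappa A) * (coef f (y w) B * kappa B)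
    * (mono A (u i w) * mono B (u i w)))
  = Ex P (fun w => (coef f (y w) A * kappa A) * (coef f (y w) B * kappa B)
    * Ex mu (fun x => mono A x * mono B x)).
  exact: condeq_Ex (condeqM (bcc A B) (direction_cond1 sG0 u_meas u_law i (bmm A B))).
rewrite Ex_sum; last by move=> A _; apply: bddrv_sum => B _; exact: bddrvM.
under eq_bigr => A _.
  rewrite Ex_sum; last by move=> B _; exact: bddrvM.
  under eq_bigr do rewrite E.
  rewrite (bigD1 A)//= big1 ?addr0; last first.
    move=> B BA; rewrite (sphere_mono_orth unif) 1?eq_sym//.
    by under eq_fun do rewrite mulr0; exact: Ex_cst.
  over.
have bA A : bddrv P full (fun w => (coef f (y w) A * kappa A) * (coef f (y w) A * kappa A)
   * Ex mu (fun x => mono A x * mono A x)).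
  by apply: bddrvM => //; exact: bddrv_cst.
rewrite -Ex_sum//= -[leRHS](Ex_cst P); apply: Ex_le.
- by apply: bddrv_sum => A _; exact: bA.
- exact: bddrv_cst.
apply: aeW => w.
(* for a fixed centre, average the pointwise energy bound over the sphere *)
have -> : \sum_A (coef f (y w) A * kappa A) * (coef f (y w) A * kappa A)
    * Ex mu (fun x => mono A x * mono A x)
  = Ex mu (fun x => \sum_A (coef f (y w) A * kappa A) ^+ 2 * (mono A x * mono A x)).
  rewrite Ex_sum; last by move=> A _; apply: bddrvZ; exact: bmm.
  by apply: eq_bigr => A _; rewrite ExZ// expr2.
rewrite -[leRHS](Ex_cst mu); apply: Ex_le.
- by apply: bddrv_sum => A _; apply: bddrvZ; exact: bmm.
- exact: bddrv_cst.
apply: filterS (sphere_ae unif) => x x1.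
have zy k : `|delta * x k| <= y w k <= 1 - `|delta * x k|.
  have := sphere_coordinate_le1 k x1; have /andP[y1 y2] := y_bounds w k.
  rewrite normrM (gtr0_norm delta0) => /(ler_wpM2l (ltW delta0)); rewrite mulr1 => xk.
  by apply/andP; split; lra.
have := odd_energy_bound f_mono f_bounds zy.
have -> : \sum_k (delta * x k) ^+ 2 = delta ^+ 2.
  rewrite -[RHS]mulr1 -x1 /dotp mulr_sumr; apply: eq_bigr => k _; ring.
rewrite big_mkcond/= => h.
apply: (@le_trans _ _ (4 * (M ^+ 2 * delta ^+ 2))); last by rewrite mulrA.
apply: le_trans (ler_wpM2l _ h) => //.
rewrite mulr_sumr; apply: ler_sum => A _.
rewrite /kappa big_split/= prodr_const -/(mono A x) exprNn.
case: ifP => oA.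
  rewrite -signr_odd oA expr1 le_eqVlt; apply/orP; left; apply/eqP; ring.
by rewrite -signr_odd oA expr0 mul1r subrr mulr0 expr0n/= mul0r mulr0.
Qed.

Definition partial k w : R := F (setder f k) (y w).

Definition two_point (i : nat) k w : R := dim / (2 * delta) * sample_diff l Y f i w * u i w k.

Definition grad_est k w : R := b%:R^-1 * \sum_(i < b) two_point i k w.

Let sd_bddrv (i : 'I_b) : bddrv P full (sample_diff l Y f i).
Proof. exact: bddrv_sample_diff. Qed.

Let uk_bddrv (i : 'I_b) k : bddrv P G1 (fun w => u i w k).
Proof. exact: (u_bddrv i (sphere_bddrv unif k)). Qed.

Lemma two_point_bddrv (i : 'I_b) k : bddrv P full (two_point i k).
Proof.
apply: bddrvM; last exact: bddrv_sub (uk_bddrv i k).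
by apply: bddrvZ.
Qed.

Lemma partial_bddrv k : bddrv P G0 (partial k).
Proof.
rewrite (_ : partial k = fun w => coef f (y w) [set k]%SET) ?coef_bddrv//.
by apply/funext => w; rewrite coef1.
Qed.

Let scale_partial k w : dim / (2 * delta) * scaled_partial k w = partial k w.
Proof.
rewrite /scaled_partial /partial; field.
by rewrite !lt0r_neq0.
Qed.

Lemma two_point_unbiased (i : 'I_b) k : condeq P G0 (two_point i k) (partial k).
Proof.
have h1 := condeqM (uk_bddrv i k) (sample_diff_cond1 sG1 q_bddrv Y_measurable Y_law f i l0).
have h2 := condeq_trans (condeq_sub G01 (condeq_eq (fun w => mulrC _ _) (fun w => mulrC _ _) h1))
  (mean_diff_unbiased i k).
apply: condeq_eq (condeqZ (dim / (2 * delta)) h2) => w; last exact: scale_partial.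
by rewrite mulrA.
Qed.

Lemma two_point_uncorrelated (i j : 'I_b) k : i != j ->
  condeq P G0 (fun w => two_point i k w * two_point j k w)
              (fun w => partial k w * partial k w).
Proof.
move=> ij.
have h1 := condeqM (bddrvM (uk_bddrv i k) (uk_bddrv j k))
  (sample_diff_cond2 sG1 q_bddrv Y_measurable Y_law f l0 ij).
have h2 : condeq P G0 (fun w => u i w k * u j w k * (sample_diff l Y f i w * sample_diff l Y f j w))
   (fun w => scaled_partial k w * scaled_partial k w).
  apply: condeq_trans (condeq_sub G01 h1) _.
  by apply: condeq_eq (mean_diff_uncorrelated k ij) => w //; rewrite /DF; ring.
apply: condeq_eq (condeqZ ((dim / (2 * delta)) ^+ 2) h2) => w.
  by rewrite /two_point; ring.
by rewrite -!scale_partial; ring.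
Qed.

(** The contributions of the exact finite difference and of the sampling of the
    sets to the second moment of one two-point estimate. *)
Definition noise_level : R := (dim ^+ 2 * M ^+ 2 + dim ^+ 2 * M ^+ 2 / (2 * l%:R * delta ^+ 2)).

Lemma two_point_sqr (i : 'I_b) : \sum_k Ex P (fun w => two_point i k w ^+ 2) <= noise_level.
Proof.
rewrite -Ex_sum; last by move=> k _; apply: bddrvX; exact: two_point_bddrv.
have -> : Ex P (fun w => \sum_k two_point i k w ^+ 2)
    = Ex P (fun w => (dim / (2 * delta)) ^+ 2 * sample_diff l Y f i w ^+ 2).
  apply: Ex_ae.
  - by apply: bddrv_sum => k _; apply: bddrvX; exact: two_point_bddrv.
  - by apply: bddrvZ; apply: bddrvX.
  - apply: filterS (u_sphere i) => w u1.
    transitivity ((dim / (2 * delta)) ^+ 2 * sample_diff l Y f i w ^+ 2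
       * dotp (u i w) (u i w)); last by rewrite u1 mulr1.
    rewrite /dotp mulr_sumr; apply: eq_bigr => k _.
    by rewrite /two_point; ring.
rewrite ExZ; last exact: bddrvX.
have h1 := sample_diff_sqr sG1 q_bddrv Y_measurable Y_law l0 f_bounds (q_cube i).
have h2 := mean_diff_sqr i.
have h3 : Ex P (fun w => sample_diff l Y f i w ^+ 2)
    <= 4 * M ^+ 2 * delta ^+ 2 + 2 * M ^+ 2 / l%:R.
  by apply: le_trans h1 _; rewrite lerD2r.
apply: le_trans (ler_wpM2l (sqr_ge0 _) h3) _.
rewrite le_eqVlt; apply/orP; left; apply/eqP; rewrite /noise_level; field.
by rewrite !lt0r_neq0// ltr0n.
Qed.

Lemma grad_est_bddrv k : bddrv P full (grad_est k).
Proof. by apply: bddrvZ; apply: bddrv_sum => i _; exact: two_point_bddrv. Qed.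

Let bn0 : b%:R != 0 :> R.
Proof. by rewrite pnatr_eq0 -lt0n. Qed.

Lemma grad_est_unbiased k : condeq P G0 (grad_est k) (partial k).
Proof.
have bp := bddrv_sub G0full (partial_bddrv k).
have h := condeqZ b%:R^-1 (condeq_sum (index_enum 'I_b) (p := xpredT) G0full
  (fun i _ => two_point_bddrv i k) (fun i _ => bp) (fun i _ => two_point_unbiased i k)).
apply: condeq_eq h => w //.
by rewrite sumr_const card_ord -[partial k w *+ b]mulr_natl mulrA mulVf// mul1r.
Qed.

(** The errors of distinct two-point estimates are uncorrelated, so averaging [b]
    of them divides the second moment by [b]. *)
Lemma grad_est_variance :
  Ex P (fun w => \sum_k (partial k w - grad_est k w) ^+ 2) <= noise_level / b%:R.
Proof.
have bp k := bddrv_sub G0full (partial_bddrv k).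
have bt i k := two_point_bddrv i k.
pose e (i : 'I_b) k w := partial k w - two_point i k w.
have be i k : bddrv P full (e i k) by exact: bddrvB.
have pt (i : 'I_b) k : Ex P (fun w => partial k w * two_point i k w) = Ex P (fun w => partial k w * partial k w).
  exact: (two_point_unbiased i k (partial_bddrv k)).
have cross i j k : i != j -> Ex P (fun w => e i k w * e j k w) = 0.
  move=> ij.
  rewrite (_ : (fun w => _) = (fun w => (partial k w * partial k w - partial k w * two_point i k w)
     - (partial k w * two_point j k w - two_point i k w * two_point j k w))); last first.
    by apply/funext => w; rewrite /e; ring.
  have bpp := bddrvM (bp k) (bp k).
  have bpt (i : 'I_b) := bddrvM (bp k) (bt i k).
  rewrite ExB; [|exact: bddrvB|by apply: bddrvB => //; exact: bddrvM].
  rewrite !ExB//; last exact: bddrvM.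
  rewrite !pt (condeq_Ex (two_point_uncorrelated k ij)); ring.
have diag i k : Ex P (fun w => e i k w * e i k w) <= Ex P (fun w => two_point i k w ^+ 2).
  rewrite (_ : (fun w => e i k w * _) = (fun w => (two_point i k w ^+ 2 + partial k w * partial k w)
     - 2 * (partial k w * two_point i k w))); last first.
    by apply/funext => w; rewrite /e; ring.
  have bpp := bddrvM (bp k) (bp k).
  have b2 := bddrvX 2 (bt i k).
  have bpt := bddrvM (bp k) (bt i k).
  rewrite ExB; [|exact: bddrvD|exact: bddrvZ].
  rewrite ExD// ExZ// pt.
  have : 0 <= Ex P (fun w => partial k w * partial k w).
    by rewrite -[leLHS](Ex_cst P); apply: Ex_le => //; [exact: bddrv_cst|apply: aeW => w; rewrite -expr2 sqr_ge0].
  lra.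
have -> : Ex P (fun w => \sum_k (partial k w - grad_est k w) ^+ 2)
   = \sum_k (b%:R^-1 ^+ 2 * \sum_i \sum_j Ex P (fun w => e i k w * e j k w)).
  rewrite Ex_sum; last by move=> k _; apply: bddrvX; apply: bddrvB => //; exact: grad_est_bddrv.
  apply: eq_bigr => k _.
  transitivity (Ex P (fun w => b%:R^-1 ^+ 2 * \sum_i \sum_j (e i k w * e j k w))).
    congr Ex; apply/funext => w.
    have -> : partial k w - grad_est k w = b%:R^-1 * \sum_i e i k w.
      rewrite /e sumrB mulrBr sumr_const card_ord -[partial k w *+ b]mulr_natl mulrA.
      by rewrite mulVf// mul1r.
    rewrite exprMn; congr (_ * _); rewrite expr2 mulr_suml; apply: eq_bigr => i _.
    by rewrite mulr_sumr.
  rewrite ExZ; last by do 2 (apply: bddrv_sum => ? _); exact: bddrvM.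
  congr (_ * _); rewrite Ex_sum; last by move=> i _; apply: bddrv_sum => ? _; exact: bddrvM.
  by apply: eq_bigr => i _; rewrite Ex_sum// => j _; exact: bddrvM.
apply: (@le_trans _ _ (\sum_k (b%:R^-1 ^+ 2 * \sum_(i < b) Ex P (fun w => two_point i k w ^+ 2)))).
  apply: ler_sum => k _; apply: ler_wpM2l; first exact: sqr_ge0.
  apply: ler_sum => i _; rewrite (bigD1 i)//= [X in _ + X]big1 ?addr0 ?diag// => j ji.
  by rewrite cross// eq_sym.
rewrite -mulr_sumr exchange_big/=.
apply: (@le_trans _ _ (b%:R^-1 ^+ 2 * \sum_(i < b) noise_level)).
  by apply: ler_wpM2l; [exact: sqr_ge0|apply: ler_sum => i _; exact: two_point_sqr].
rewrite sumr_const card_ord -[noise_level *+ b]mulr_natl.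
by rewrite le_eqVlt; apply/orP; left; apply/eqP; field.
Qed.

End Step.

(** * A run of the algorithm *)

Section Run.
Context {R : realType} {Omega : finType} {disp : measure_display}.
Context {T : measurableType disp} {P : probability T R}.
Context {f : {set Omega} -> R} {I : {set {set Omega}}}.
Context {rnd : (Omega -> R) -> {set Omega} -> R} {delta : R} {N b l : nat}.
Local Notation V := (vec R Omega).
Local Notation full := (@measurable disp T).
Local Notation F := multilinear_ext.
Local Notation dim := (#|Omega|%:R : R).
Local Notation K := (transformed_set I delta).
Local Notation D1 := (diam K).
Variable M : R.
Hypothesis f_mono : monotone_set_fun f.
Hypothesis f_bounds : forall A, 0 <= f A <= M.
Hypothesis matroid : is_matroid I.
Hypothesis delta0 : 0 < delta.
Hypothesis N0 : (0 < N)%N.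
Hypothesis b0 : (0 < b)%N.
Hypothesis l0 : (0 < l)%N.
Hypothesis K0 : K !=set0.
Variable run : discrete_bbg P f I rnd delta N (fun=> b) (fun _ _ => l)
                 (fun t => 2 / ((t + 3)%:R `^ (2 / 3))).

Lemma dim_gt0 : (0 < #|Omega|)%N.
Proof. exact: sphere_nonempty (uniform_lawP run). Qed.

Lemma M_ge0 : 0 <= M.
Proof. by have /andP[] := f_bounds finset.set0; apply: le_trans. Qed.

Lemma vertexK t w : (1 <= t <= N)%N -> K (vertex run t w).
Proof. by move=> tN; have [] := vertex_argmax run w tN. Qed.

Lemma iterateE t w k : (t <= N)%N ->
  iterate run t.+1 w k = N%:R^-1 * \sum_(s < t) vertex run s.+1 w k.
Proof.
elim: t => [_|t IH tN]; first by rewrite iterate_init big_ord0 mulr0.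
by rewrite iterate_step// IH ?(ltnW tN)// big_ord_recr/= mulrDr [_ / N%:R]mulrC.
Qed.

Lemma hist_mono s t : (s <= t <= N)%N -> hist run s `<=` hist run t.
Proof.
move=> /andP[st tN]; elim: t st tN => [|t IH]; first by rewrite leqn0 => /eqP -> _ A.
rewrite leq_eqVlt ltnS => /orP[/eqP -> _ A //|st] tN.
have [h1 h2] := hist_incr run (t := t.+1) tN.
exact: subset_trans (IH st (ltnW tN)) (subset_trans h1 h2).
Qed.

Lemma hist_full t : hist run t `<=` full.
Proof. exact: (hist_sigma run t).2. Qed.

Lemma vertex_bounds t w k : (1 <= t <= N)%N -> 0 <= vertex run t w k <= 1 - 2 * delta.
Proof. by move=> tN; have [h _] := vertexK w tN; exact: h. Qed.

Lemma vertex_bddrv t k : (1 <= t <= N)%N ->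
  bddrv P (hist run t) (fun w => vertex run t w k).
Proof.
move=> tN; split.
  exact: (meas_wrt_comp (measurable_coordinate k) (vertex_adapted run tN)).
exists (1 - 2 * delta); apply: aeW => w; have /andP[h1 h2] := vertex_bounds w k tN.
by rewrite ger0_norm.
Qed.

Lemma iterate_bddrv t k : (t <= N)%N ->
  bddrv P (hist run t) (fun w => iterate run t.+1 w k).
Proof.
move=> tN.
rewrite (_ : (fun w => _) = fun w => N%:R^-1 * \sum_(s < t) vertex run s.+1 w k); last first.
  by apply/funext => w; rewrite iterateE.
apply: bddrvZ; apply: bddrv_sum => s _.
apply: (@bddrv_sub _ _ _ _ (hist run s.+1)).
  by apply: hist_mono; rewrite ltn_ord.
by apply: vertex_bddrv; rewrite /= (leq_trans (ltn_ord s)).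
Qed.

Lemma iterate_bounds t w k : (t <= N)%N ->
  0 <= iterate run t.+1 w k <= 1 - 2 * delta.
Proof.
move=> tN; rewrite iterateE//.
have vb (s : 'I_t) : 0 <= vertex run s.+1 w k <= 1 - 2 * delta.
  by apply: vertex_bounds; rewrite /= (leq_trans (ltn_ord s)).
have NR : 0 < N%:R :> R by rewrite ltr0n.
have d2 : 0 <= 1 - 2 * delta.
  by have /andP[] := @vertex_bounds 1%N w k N0; apply: le_trans.
apply/andP; split.
  rewrite mulr_ge0 ?invr_ge0 ?ler0n// sumr_ge0// => s _.
  by have /andP[] := vb s.
rewrite mulrC ler_pdivrMr//.
apply: (@le_trans _ _ (\sum_(s < t) (1 - 2 * delta))).
  by apply: ler_sum => s _; have /andP[] := vb s.
rewrite sumr_const card_ord -[leLHS]mulr_natr; apply: ler_wpM2l => //.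
by rewrite ler_nat.
Qed.

Definition center t w : Omega -> R := fun k => delta + iterate run t w k.

Lemma center_bounds t w k : (t <= N)%N -> delta <= center t.+1 w k <= 1 - delta.
Proof. by move=> tN; have /andP[h1 h2] := iterate_bounds w k tN; rewrite /center; apply/andP; split; lra. Qed.

Lemma center_cube t w : (t <= N)%N -> in_cube (center t.+1 w).
Proof.
move=> tN k; have /andP[h1 h2] := center_bounds w k tN; have d0 := delta0.
by apply/andP; split; lra.
Qed.

Lemma center_bddrv t k : (t <= N)%N -> bddrv P (hist run t) (fun w => center t.+1 w k).
Proof. by move=> tN; apply: bddrvD; [exact: bddrv_cst|exact: iterate_bddrv]. Qed.

Definition grad t k w : R := F (setder f k) (center t w).

Lemma grad_bddrv t k : (t <= N)%N -> bddrv P (hist run t) (grad t.+1 k).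
Proof. by move=> tN; apply: partial_bddrv => j; exact: center_bddrv. Qed.

Lemma draw_measurable t i s j : (1 <= t <= N)%N -> (i < b)%N -> (j < l)%N ->
  forall A, measurable [set w | draw run t i s j w = A].
Proof.
by move=> tN ib jl A; apply: (@hist_full t); exact: (draw_adapted run s tN ib jl A).
Qed.

Lemma gradient_unbiased t k : (t < N)%N ->
  condeq P (hist run t) (fun w => gradient run t.+1 w k) (grad t.+1 k).
Proof.
move=> tN; have [h01 _] := hist_incr run (t := t.+1) tN.
have := @grad_est_unbiased R Omega _ T P (uniform_law run) (hist run t) (hist_dir run t.+1)
  b l delta f (center t.+1) (direction run t.+1) (draw run t.+1)
  (uniform_lawP run) b0 l0 delta0 (hist_sigma run t) (hist_dir_sigma run t.+1) h01
  (fun k => center_bddrv k (ltnW tN)).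
move=> /(_ (fun i ib => direction_adapted run (t := t.+1) tN ib)).
move=> /(_ (direction_law (d := run) (t := t.+1) tN)).
move=> /(_ (fun i s j ib jl => draw_measurable s (t := t.+1) tN ib jl)).
move=> /(_ (draw_law (d := run) (t := t.+1) tN)).
exact.
Qed.

Local Notation sigma2 := (noise_level (Omega := Omega) l delta M / b%:R).

Lemma gradient_variance t : (t < N)%N ->
  Ex P (fun w => \sum_k (grad t.+1 k w - gradient run t.+1 w k) ^+ 2) <= sigma2.
Proof.
move=> tN; have [h01 _] := hist_incr run (t := t.+1) tN.
have := @grad_est_variance R Omega _ T P (uniform_law run) (hist run t) (hist_dir run t.+1)
  b l delta M f (center t.+1) (direction run t.+1) (draw run t.+1)
  (uniform_lawP run) b0 l0 delta0 f_mono f_bounds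
  (hist_sigma run t) (hist_dir_sigma run t.+1) h01
  (fun k => center_bddrv k (ltnW tN)) (fun w k => center_bounds w k (ltnW tN)).
move=> /(_ (fun i ib => direction_adapted run (t := t.+1) tN ib)).
move=> /(_ (direction_law (d := run) (t := t.+1) tN)).
move=> /(_ (fun i s j ib jl => draw_measurable s (t := t.+1) tN ib jl)).
move=> /(_ (draw_law (d := run) (t := t.+1) tN)).
exact.
Qed.

Lemma gradient_bddrv t k : (t < N)%N ->
  bddrv P (hist run t.+1) (fun w => gradient run t.+1 w k).
Proof.
move=> tN; have [_ h1] := hist_incr run (t := t.+1) tN.
have [h01 _] := hist_incr run (t := t.+1) tN.
have u_adapted i (ib : (i < b)%N) := direction_adapted run (t := t.+1) (i := i) tN ib.
have u_law := direction_law (d := run) (t := t.+1) tN.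
have u_meas i (ib : (i < b)%N) (A : set V) :
    measurable A -> measurable (direction run t.+1 i @^-1` A).
  by move=> mA; apply: (hist_dir_sigma run t.+1).2; exact: u_adapted.
have bu (i : 'I_b) : bddrv P (hist run t.+1) (fun w => direction run t.+1 i w k).
  apply: bddrv_sub h1 _.
  exact: (same_law_bddrv (measurable_direction u_meas i)
    (direction_law1 (hist_sigma run t) u_law i) (u_adapted _ (ltn_ord i))
    (sphere_bddrv (uniform_lawP run) k)).
have bf (i : 'I_b) s : bddrv P (hist run t.+1)
    (fun w => sample_mean f l (fun j => draw run t.+1 i s j w)).
  apply: bddrvZ; apply: bddrv_sum => j _; apply: bddrv_discrete => A.
  exact: (draw_adapted run s (t := t.+1) tN (ltn_ord i) (ltn_ord j) A).
apply: bddrvZ; apply: bddrv_sum => i _; apply: bddrvM => //.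
by apply: bddrvZ; exact: bddrvB.
Qed.

Lemma momentum_bddrv t k : (t <= N)%N ->
  bddrv P (hist run t) (fun w => momentum run t w k).
Proof.
elim: t => [_|t IH tN].
  rewrite (_ : (fun w => momentum run 0%N w k) = fun=> 0); first exact: bddrv_cst.
  by apply/funext => w; exact: momentum_init.
rewrite (_ : (fun w => momentum run t.+1 w k) = fun w => (1 - 2 / ((t.+1 + 3)%:R `^ (2 / 3))) * momentum run t w k
    + 2 / ((t.+1 + 3)%:R `^ (2 / 3)) * gradient run t.+1 w k); last first.
  by apply/funext => w; rewrite momentum_step.
apply: bddrvD; apply: bddrvZ; last exact: gradient_bddrv.
by apply: bddrv_sub (IH (ltnW tN)); apply: hist_mono; rewrite leqnSn.
Qed.

Lemma vertex_norm t w : (1 <= t <= N)%N -> \sum_k vertex run t w k ^+ 2 <= D1 ^+ 2.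
Proof.
move=> tN; have K00 := transformed_set0 matroid (ltW delta0) K0.
have := transformed_set_diam (vertexK w tN) K00.
have -> : l2norm (fun k => vertex run t w k - 0) = Num.sqrt (\sum_k vertex run t w k ^+ 2).
  by congr Num.sqrt; apply: eq_bigr => k _; rewrite subr0 expr2.
move=> h; rewrite -[leLHS]sqr_sqrtr; last by apply: sumr_ge0 => k _; exact: sqr_ge0.
by rewrite ler_sqr ?nnegrE ?sqrtr_ge0//; apply: le_trans h; exact: sqrtr_ge0.
Qed.

Lemma centerS t w k : (1 <= t <= N)%N ->
  center t.+1 w k = center t w k + vertex run t w k / N%:R.
Proof. by move=> tN; rewrite /center iterate_step// addrA. Qed.

Lemma grad_drift t w : (t < N)%N -> (0 < t)%N ->
  \sum_k (grad t.+1 k w - grad t k w) ^+ 2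
    <= dim * (dim - 1) * M ^+ 2 * D1 ^+ 2 / N%:R ^+ 2.
Proof.
move=> tN t0; have tN' : (0 < t <= N)%N by rewrite t0 ltnW.
have c1 := center_cube w (ltnW tN).
have c0 : in_cube (center t w).
  by case: t t0 tN {tN' c1} => // t _ tN; apply: center_cube; rewrite ltnW// ltnW.
apply: le_trans (gradient_lip dim_gt0 f_mono f_bounds c0 c1) _.
rewrite -[leRHS]mulrA; apply: ler_wpM2l.
  by rewrite mulr_ge0 ?sqr_ge0// mulr_ge0 ?dim_sub1_ge0 ?dim_gt0.
rewrite (eq_bigr (fun k => vertex run t w k ^+ 2 / N%:R ^+ 2)).
  by rewrite -mulr_suml; apply: ler_wpM2r; [rewrite invr_ge0 sqr_ge0|exact: vertex_norm].
by move=> k _; rewrite centerS// addrAC subrr add0r exprMn exprVn.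
Qed.

Lemma grad_sqr t w : (t <= N)%N -> \sum_k grad t.+1 k w ^+ 2 <= dim * M ^+ 2.
Proof.
move=> tN; have c := center_cube w tN.
apply: (@le_trans _ _ (\sum_(k : Omega) M ^+ 2)); last by rewrite sumr_const -[leLHS]mulr_natl.
apply: ler_sum => k _; rewrite -real_normK ?num_real// ler_sqr ?nnegrE ?M_ge0//.
apply: normr_multilinear_ext => // S.
by have /andP[h0 h1] := setder_bounds k S f_mono f_bounds; rewrite ger0_norm.
Qed.

(** Since the estimate is unbiased given the past, the error splits into an old
    part and a fresh noise that are orthogonal. *)
Lemma momentum_error_step t rho : (t < N)%N ->
  rho = 2 / ((t.+1 + 3)%:R `^ (2 / 3)) ->
  Ex P (fun w => \sum_k (grad t.+1 k w - momentum run t.+1 w k) ^+ 2)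
  <= (1 - rho) ^+ 2 * Ex P (fun w => \sum_k (grad t.+1 k w - momentum run t w k) ^+ 2)
     + rho ^+ 2 * sigma2.
Proof.
move=> tN rhoE; have tN' := ltnW tN.
pose a k w := grad t.+1 k w - momentum run t w k.
pose g k w := grad t.+1 k w - gradient run t.+1 w k.
have ba k : bddrv P (hist run t) (a k).
  by apply: bddrvB; [exact: grad_bddrv|exact: momentum_bddrv].
have baf k := bddrv_sub (@hist_full t) (ba k).
have bgr k := bddrv_sub (@hist_full t.+1) (gradient_bddrv k tN).
have bG k := bddrv_sub (@hist_full t) (grad_bddrv k tN').
have bg k : bddrv P full (g k) by exact: bddrvB.
have ag0 k : Ex P (fun w => a k w * g k w) = 0.
  have := gradient_unbiased k tN (ba k).
  rewrite (_ : (fun w => a k w * g k w) = (fun w => a k w * grad t.+1 k w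
     - a k w * gradient run t.+1 w k)); last by apply/funext => w; rewrite /g mulrBr.
  by rewrite ExB; [move=> ->; rewrite subrr|exact: bddrvM|exact: bddrvM].
have E : (fun w => \sum_k (grad t.+1 k w - momentum run t.+1 w k) ^+ 2)
  = (fun w => ((1 - rho) ^+ 2 * (\sum_k a k w ^+ 2)
      + (2 * rho * (1 - rho)) * \sum_k a k w * g k w) + rho ^+ 2 * \sum_k g k w ^+ 2).
  apply/funext => w; rewrite !mulr_sumr -!big_split/=; apply: eq_bigr => k _.
  by rewrite momentum_step// -rhoE /a /g; ring.
have ba2 : bddrv P full (fun w => \sum_k a k w ^+ 2).
  by apply: bddrv_sum => k _; exact: bddrvX.
have bg2 : bddrv P full (fun w => \sum_k g k w ^+ 2).
  by apply: bddrv_sum => k _; exact: bddrvX.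
have bag : bddrv P full (fun w => \sum_k a k w * g k w).
  by apply: bddrv_sum => k _; exact: bddrvM.
rewrite E ExD; [|by apply: bddrvD; exact: bddrvZ|exact: bddrvZ].
rewrite ExD; [|exact: bddrvZ|exact: bddrvZ].
rewrite !ExZ// [Ex P (fun w => \sum_k a k w * g k w)](_ : _ = 0); last first.
  rewrite Ex_sum; last by move=> k _; exact: bddrvM.
  by rewrite big1.
rewrite mulr0 addr0 lerD2l; apply: ler_wpM2l; first exact: sqr_ge0.
exact: gradient_variance.
Qed.

Lemma error_bddrv t u : (t <= N)%N -> (u <= N)%N ->
  bddrv P full (fun w => \sum_k (grad t.+1 k w - momentum run u w k) ^+ 2).
Proof.
move=> tN uN; apply: bddrv_sum => k _; apply: bddrvX; apply: bddrvB.
  exact: bddrv_sub (@hist_full t) (grad_bddrv k tN).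
exact: bddrv_sub (@hist_full u) (momentum_bddrv k uN).
Qed.

(** Between two iterations the gradient drifts; the old error is separated from the
    drift by [(x + z)^2 <= (1 + r / 2) x^2 + (1 + 2 / r) z^2]. In the first
    iteration the momentum is zero and the squared gradient itself is the error. *)
Lemma momentum_error (Q : R) t : (t < N)%N ->
  4 * sigma2 + 16 * (dim * (dim - 1) * M ^+ 2 * D1 ^+ 2) <= Q ->
  dim * M ^+ 2 <= Q / 4%:R `^ (2 / 3) ->
  Ex P (fun w => \sum_k (grad t.+1 k w - momentum run t.+1 w k) ^+ 2)
    <= Q / (t.+1 + 3).+1%:R `^ (2 / 3).
Proof.
move=> + hQ hQ0.
have L0 : 0 <= dim * (dim - 1) * M ^+ 2 * D1 ^+ 2.
  rewrite mulr_ge0 ?sqr_ge0// mulr_ge0 ?sqr_ge0// mulr_ge0 ?ler0n//.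
  exact: dim_sub1_ge0 dim_gt0.
have s0 : 0 <= sigma2.
  rewrite divr_ge0// addr_ge0//; first by rewrite mulr_ge0 ?sqr_ge0.
  apply: divr_ge0; first by rewrite mulr_ge0 ?sqr_ge0.
  by rewrite mulr_ge0 ?sqr_ge0// mulr_ge0 ?ler0n.
elim: t => [|t IH] tN; pose rho n : R := 2 / (n%:R `^ (2 / 3)).
  apply: le_trans (momentum_error_step tN erefl) _.
  have A0 : 0 <= dim * M ^+ 2 by rewrite mulr_ge0 ?sqr_ge0.
  have n4 : (4 <= 4 * N)%N by rewrite leq_pmulr.
  have := momentum_recursion (rho := rho 4%N) erefl (leqnn 4) n4 L0 s0 hQ A0 hQ0.
  apply: le_trans; rewrite lerD2r; apply: ler_wpM2l; first exact: sqr_ge0.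
  have r0 : 0 <= rho 4%N by rewrite divr_ge0 ?powR_ge0.
  apply: (@le_trans _ _ (dim * M ^+ 2)).
    rewrite -[leRHS](Ex_cst P); apply: Ex_le; [exact: error_bddrv|exact: bddrv_cst|].
    apply: aeW => w; apply: le_trans _ (grad_sqr w (leq0n N)).
    by apply: ler_sum => k _; rewrite momentum_init subr0.
  rewrite mulrDl mul1r -addrA lerDl addr_ge0// mulr_ge0 ?divr_ge0 ?sqr_ge0//.
  by rewrite addr_ge0// divr_ge0.
apply: le_trans (momentum_error_step tN erefl) _.
have tN' := ltnW tN.
have eb := error_bddrv (ltnW tN') tN'.
have eb2 := @error_bddrv t.+1 t.+1 tN' tN'.
set A := Ex P (fun w => \sum_k (grad t.+1 k w - momentum run t.+1 w k) ^+ 2) in IH.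
have A0 : 0 <= A.
  rewrite -[leLHS](Ex_cst P); apply: Ex_le; [exact: bddrv_cst|exact: eb|].
  by apply: aeW => w; apply: sumr_ge0 => k _; exact: sqr_ge0.
have nN : (t.+2 + 3 <= 4 * N)%N.
  apply: (@leq_trans (4 * t.+2)); last by rewrite leq_mul2l.
  by rewrite mulSn leq_add2l; case: (t) => // t'; rewrite mulnS.
have n4 : (4 <= t.+2 + 3)%N by rewrite addnC.
have := momentum_recursion (rho := rho (t.+2 + 3)%N) erefl n4 nN L0 s0 hQ A0 (IH tN').
apply: le_trans; rewrite lerD2r; apply: ler_wpM2l; first exact: sqr_ge0.
rewrite -/(rho _); set r := rho _.
have r0 : 0 < r by rewrite divr_gt0// powR_gt0// ltr0n addn_gt0.
rewrite -[X in _ <= _ + X](Ex_cst P) /A -ExZ; last exact: eb.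
rewrite -ExD; [|by apply: bddrvZ; exact: eb|exact: bddrv_cst].
apply: Ex_le; [exact: eb2| |].
  by apply: bddrvD; [apply: bddrvZ; exact: eb|exact: bddrv_cst].
apply: aeW => w.
apply: (@le_trans _ _ ((1 + r / 2) * \sum_k (grad t.+1 k w - momentum run t.+1 w k) ^+ 2
   + (1 + 2 / r) * \sum_k (grad t.+2 k w - grad t.+1 k w) ^+ 2)).
  rewrite !mulr_sumr -big_split/=; apply: ler_sum => k _.
  set x := grad t.+1 k w - _; set z := grad t.+2 k w - grad t.+1 k w.
  have -> : grad t.+2 k w - momentum run t.+1 w k = x + z by rewrite /x /z; ring.
  have : 0 <= (r * x - 2 * z) ^+ 2 / (2 * r).
    by rewrite divr_ge0 ?sqr_ge0// mulr_ge0// ltW.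
  have -> : (r * x - 2 * z) ^+ 2 / (2 * r) = r / 2 * x ^+ 2 - 2 * x * z + 2 / r * z ^+ 2.
    by field; rewrite lt0r_neq0.
  rewrite -subr_ge0 => h; rewrite -subr_ge0; apply: le_trans h _.
  by rewrite le_eqVlt; apply/orP; left; apply/eqP; ring.
rewrite lerD2l; apply: ler_wpM2l; last exact: grad_drift.
by rewrite addr_ge0// divr_ge0// ltW.
Qed.

Definition error t w : R := l2norm (fun k => grad t k w - momentum run t w k).

(** The point [s * 1_X] competes in the linear maximization, so the vertex gains at
    least [s (f X - F) / N], up to the error of the momentum as a gradient. *)
Lemma greedy_step (s : R) (X : {set Omega}) t w : submodular f -> 0 <= s <= 1 ->
  K (fun k => s * indicator X k) -> (t < N)%N ->
  s * f X - F f (center t.+2 w) <= (1 - N%:R^-1) * (s * f X - F f (center t.+1 w))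
    + (D1 * error t.+1 w / N%:R
       + M * Num.sqrt (dim * (dim - 1)) * D1 ^+ 2 / N%:R ^+ 2).
Proof.
move=> sf /andP[s0 s1] KX tN.
have NR : 0 < N%:R :> R by rewrite ltr0n.
have c1 := center_cube w (ltnW tN); have c2 := center_cube w tN.
pose v := vertex run t.+1 w; pose m := momentum run t.+1 w.
pose g k := grad t.+1 k w; pose e k := g k - m k.
have zy k : center t.+2 w k - center t.+1 w k = v k / N%:R.
  by rewrite centerS// addrAC subrr add0r.
have le k : center t.+1 w k <= center t.+2 w k.
  rewrite -subr_ge0 zy divr_ge0 ?ler0n//.
  by have /andP[] := @vertex_bounds t.+1 w k tN.
have := multilinear_ext_smooth dim_gt0 f_mono f_bounds c1 c2 le.
have -> : \sum_k (center t.+2 w k - center t.+1 w k) * F (setder f k) (center t.+1 w)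
    = dotp v g / N%:R.
  by rewrite /dotp mulr_suml; apply: eq_bigr => k _; rewrite zy /g /grad; ring.
have -> : \sum_k (center t.+2 w k - center t.+1 w k) ^+ 2 = (\sum_k v k ^+ 2) / N%:R ^+ 2.
  by rewrite mulr_suml; apply: eq_bigr => k _; rewrite zy exprMn exprVn.
have hv : M * Num.sqrt (dim * (dim - 1)) * ((\sum_k v k ^+ 2) / N%:R ^+ 2)
    <= M * Num.sqrt (dim * (dim - 1)) * D1 ^+ 2 / N%:R ^+ 2.
  rewrite mulrA; apply: ler_wpM2r; first by rewrite invr_ge0 sqr_ge0.
  apply: ler_wpM2l; first by rewrite mulr_ge0 ?sqrtr_ge0 ?M_ge0.
  exact: (@vertex_norm t.+1).
have [Kv vmax] := vertex_argmax run w (t := t.+1) tN.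
have hm := vmax _ KX.
pose x k := s * indicator X k.
have hx : s * (f X - F f (center t.+1 w)) <= dotp x g.
  have -> : dotp x g = s * \sum_(k in X) F (setder f k) (center t.+1 w).
    rewrite /dotp mulr_sumr [RHS]big_mkcond/=; apply: eq_bigr => k _.
    by rewrite /x /indicator; case: (k \in X); rewrite ?mulr1// mulr0 mul0r.
  apply: ler_wpM2l => //; apply: sum_setder_ge => // A.
  by have /andP[] := f_bounds A.
have he : dotp (fun k => x k - v k) e <= D1 * error t.+1 w.
  apply: le_trans (cauchy_schwarz _ _) _; apply: ler_wpM2r; first exact: sqrtr_ge0.
  exact: transformed_set_diam.
(* the last term is nonnegative as [v] maximizes [dotp _ m] *)
have dE : dotp v g = dotp x g - dotp (fun k => x k - v k) e + (dotp v m - dotp x m).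
  rewrite /dotp -!sumrB -big_split/=; apply: eq_bigr => k _; rewrite /e; ring.
have hvg : s * (f X - F f (center t.+1 w)) - D1 * error t.+1 w <= dotp v g.
  rewrite dE; move: hx he hm; rewrite -/v -/m -/x; lra.
have F0 : 0 <= F f (center t.+1 w).
  by apply: multilinear_ext_ge0 => // A; have /andP[] := f_bounds A.
have hF : s * f X - F f (center t.+1 w) - D1 * error t.+1 w <= dotp v g.
  by apply: le_trans hvg; rewrite lerD2r mulrBr lerD2l lerN2 ler_piMl.
have := ler_wpM2r (ltW (_ : 0 < N%:R^-1)) hF; rewrite invr_gt0 => /(_ NR).
move: hv; set C := M * _ * _ ^+ 2 / _; set Sv := M * _ * _.
set a := F f _; set a' := F f _; set dg := dotp v g / _.
rewrite !mulrBl [D1 * _ * _^-1]mulrC; lra.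
Qed.

Lemma value_bddrv t : (t <= N)%N -> bddrv P full (fun w => F f (center t.+1 w)).
Proof.
move=> tN; apply: bddrv_sub (@hist_full t) _.
apply: bddrv_sum => S _; apply: bddrvZ; apply: bddrvM; apply: bddrv_prod => k _.
  exact: center_bddrv.
by apply: bddrvB; [exact: bddrv_cst|exact: center_bddrv].
Qed.

(** The expected error enters through [err <= (err^2 / r + r) / 2], where [r] bounds
    the root mean square of the error; this is the Jensen step. *)
Lemma expected_gap (s Q : R) (X : {set Omega}) : submodular f -> 0 <= s <= 1 ->
  K (fun k => s * indicator X k) -> 0 < Q ->
  (forall t, (t < N)%N ->
    Ex P (fun w => \sum_k (grad t.+1 k w - momentum run t.+1 w k) ^+ 2)
    <= Q / (t.+1 + 3).+1%:R `^ (2 / 3)) ->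
  (1 - 1 / expR 1) * (s * f X) - Ex P (fun w => F f (center N.+1 w))
    <= 3 * D1 * Num.sqrt Q / N%:R `^ (1 / 3)
     + M * Num.sqrt (dim * (dim - 1)) * D1 ^+ 2 / N%:R.
Proof.
move=> sf s01 KX Q0 hE; have /andP[s0 s1] := s01.
have NR : 0 < N%:R :> R by rewrite ltr0n.
have K00 := transformed_set0 matroid (ltW delta0) K0.
have D0 : 0 <= D1 by apply: le_trans (transformed_set_diam K00 K00); exact: sqrtr_ge0.
(* [r t ^+ 2] bounds the mean squared error of iteration [t.+1] *)
pose r t : R := Num.sqrt Q / (t + 5)%:R `^ (1 / 3).
have r0 t : 0 < r t by rewrite divr_gt0 ?sqrtr_gt0// cbrt_gt0// addnC.
have r2 t : r t ^+ 2 = Q / (t.+1 + 3).+1%:R `^ (2 / 3).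
  rewrite expr_div_n sqr_sqrtr ?ltW// (_ : (t.+1 + 3).+1 = (t + 5)%N) ?cbrt_sqr//.
  by rewrite addSn -!addnS.
pose e2 t w := \sum_k (grad t.+1 k w - momentum run t.+1 w k) ^+ 2.
pose C := M * Num.sqrt (dim * (dim - 1)) * D1 ^+ 2 / N%:R ^+ 2.
have C0 : 0 <= C by rewrite divr_ge0 ?sqr_ge0// mulr_ge0 ?sqr_ge0// mulr_ge0 ?sqrtr_ge0 ?M_ge0.
pose B t w := D1 / N%:R * ((e2 t w / r t + r t) / 2) + C.
have e20 t w : 0 <= e2 t w by apply: sumr_ge0 => k _; exact: sqr_ge0.
have be t : (t < N)%N -> bddrv P full (e2 t).
  by move=> tN; apply: error_bddrv => //; exact: ltnW.
have bB t : (t < N)%N -> bddrv P full (B t).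
  move=> tN; rewrite (_ : B t = fun w => D1 / N%:R * (2^-1 * ((r t)^-1 * e2 t w + r t)) + C).
    apply: bddrvD; last exact: bddrv_cst.
    do 2 apply: bddrvZ; apply: bddrvD; last exact: bddrv_cst.
    by apply: bddrvZ; exact: be.
  by apply/funext => w; rewrite /B [_ / 2]mulrC [_ / r t]mulrC.
have B0 t w : 0 <= B t w.
  rewrite /B addr_ge0// mulr_ge0 ?divr_ge0// addr_ge0 ?divr_ge0// ltW//.
have err_le t w : error t.+1 w <= (e2 t w / r t + r t) / 2.
  have -> : e2 t w = error t.+1 w ^+ 2.
    rewrite /error sqr_sqrtr ?dotp_ge0//; apply: eq_bigr => k _; exact: expr2.
  have : 0 <= (error t.+1 w - r t) ^+ 2 / (2 * r t).
    by rewrite divr_ge0 ?sqr_ge0// mulr_ge0// ltW.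
  rewrite -[error t.+1 w <= _]subr_ge0 (_ : _ / (2 * r t) = (error t.+1 w ^+ 2 / r t + r t) / 2 - error t.+1 w)//.
  by field; rewrite lt0r_neq0.
have gap w : s * f X - F f (center N.+1 w) <= 1 / expR 1 * (s * f X) + \sum_(t < N) B t w.
  have N1 : (N%:R^-1 : R) <= 1 by rewrite invf_le1// ler1n.
  have N2 : 0 <= 1 - (N%:R^-1 : R) <= 1.
    by rewrite subr_ge0 N1 gerBl invr_ge0 ler0n.
  apply: (le_trans (@contraction_unroll _ (1 - N%:R^-1) (fun t => s * f X - F f (center t.+1 w))
    (fun t => B t w) N N2 (fun t _ => B0 t w) _)).
    move=> t tN; apply: le_trans (greedy_step w sf s01 KX tN) _.
    rewrite lerD2l /B; apply: lerD; last exact: lexx.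
    by rewrite [leLHS]mulrAC; apply: ler_wpM2l => //; rewrite divr_ge0.
  rewrite lerD2r; apply: (@le_trans _ _ ((1 - N%:R^-1) ^+ N * (s * f X))).
    apply: ler_wpM2l; first by rewrite exprn_ge0//; have /andP[] := N2.
    rewrite gerBl; apply: multilinear_ext_ge0; first exact: center_cube.
    by move=> A; have /andP[] := f_bounds A.
  apply: ler_wpM2r; last exact: pow_one_minus_inv.
  by rewrite mulr_ge0//; have /andP[] := f_bounds X.
have bF := value_bddrv (leqnn N).
have bsum : bddrv P full (fun w => \sum_(t < N) B t w).
  by apply: bddrv_sum => t _; exact: bB.
have EB t : (t < N)%N -> Ex P (B t) <= D1 / N%:R * r t + C.
  move=> tN; rewrite (_ : B t = fun w => D1 / N%:R / 2 / r t * e2 t w + (D1 / N%:R * r t / 2 + C)).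
    rewrite ExD; [|by apply: bddrvZ; exact: be|exact: bddrv_cst].
    rewrite Ex_cst ExZ; last exact: be.
    rewrite addrA lerD2r.
    have h := hE t tN; rewrite -r2 in h.
    apply: (@le_trans _ _ (D1 / N%:R / 2 / r t * r t ^+ 2 + D1 / N%:R * r t / 2)).
      rewrite lerD2r; apply: ler_wpM2l => //.
      by rewrite !divr_ge0// ltW.
    rewrite le_eqVlt; apply/orP; left; apply/eqP; field.
    by rewrite !lt0r_neq0.
  by apply/funext => w; rewrite /B; field; rewrite !lt0r_neq0.
have step : s * f X - Ex P (fun w => F f (center N.+1 w))
    <= 1 / expR 1 * (s * f X) + \sum_(t < N) (D1 / N%:R * r t + C).
  rewrite -[X in X - _](Ex_cst P) -ExB//; last exact: bddrv_cst.
  apply: (@le_trans _ _ (Ex P (fun w => 1 / expR 1 * (s * f X) + \sum_(t < N) B t w))).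
    apply: Ex_le; [by apply: bddrvB => //; exact: bddrv_cst|
      by apply: bddrvD => //; exact: bddrv_cst|exact: aeW].
  rewrite ExD//; last exact: bddrv_cst.
  rewrite Ex_cst lerD2l Ex_sum; last by move=> t _; exact: bB.
  by apply: ler_sum => t _; exact: EB.
have sumC : \sum_(t < N) (D1 / N%:R * r t + C)
   <= 3 * D1 * Num.sqrt Q / N%:R `^ (1 / 3)
     + M * Num.sqrt (dim * (dim - 1)) * D1 ^+ 2 / N%:R.
  rewrite big_split/= sumr_const card_ord; apply: lerD.
    have a0 := cbrt_gt0 (R := R) N0; have a3 := cbrt_cube (R := R) N.
    rewrite -mulr_sumr -mulr_sumr mulrA.
    apply: le_trans (ler_wpM2l _ (sum_inv_cbrt N)) _.
      by rewrite mulr_ge0 ?sqrtr_ge0// divr_ge0.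
    rewrite -{1}a3 le_eqVlt; apply/orP; left; apply/eqP; field.
    by rewrite lt0r_neq0.
  rewrite -[C *+ N]mulr_natl /C le_eqVlt; apply/orP; left; apply/eqP; field.
  by rewrite lt0r_neq0.
by apply: le_trans sumC; rewrite mulrBl mul1r; lra.
Qed.

Lemma final_polytope w : matroid_polytope I (fun k => iterate run N.+1 w k + delta).
Proof.
rewrite (_ : (fun k => _) = (fun k => N%:R^-1 * \sum_(s < N) vertex run s.+1 w k + delta)).
  by apply: transformed_set_avg => // s; apply: vertexK; rewrite /= ltn_ord.
by apply/funext => k; rewrite iterateE.
Qed.

(** The law of the output given the run is the rounding kernel at a point of the
    polytope, where rounding is lossless. *)
Lemma output_mean : lossless_rounding f I rnd ->
  Ex P (fun w => F f (center N.+1 w)) <= Ex P (fun w => f (output run w)).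
Proof.
move=> rl.
pose Z w : Omega -> R := fun k => iterate run N.+1 w k + delta.
have ZK w : matroid_polytope I (Z w) by exact: final_polytope.
have mZ : measurable_fun setT (Z : T -> V).
  apply: measurable_vec => k; apply: measurable_funD => //.
  by apply/meas_wrt_full; exact: (bddrv_sub (@hist_full N) (iterate_bddrv k (leqnn N))).1.
have rnd1 w A : rnd (Z w) A <= 1.
  rewrite -(rounding_sum1 rl (ZK w)) (bigD1 A)//= lerDl sumr_ge0// => A' _.
  exact: rounding_ge0 rl _ _ (ZK w).
have brnd A : bddrv P full (fun w => rnd (Z w) A).
  split.
    apply/meas_wrt_full => _ B mB; rewrite setTI.
    have := mZ measurableT _ (rounding_measurable rl A mB); rewrite setTI.
    by congr measurable; apply/seteqP; split => w /=; [case|].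
  exists 1; apply: aeW => w; rewrite ger0_norm//.
  exact: rounding_ge0 rl _ _ (ZK w).
have brf A := bddrvM (brnd A) (bddrv_cst P full (f A)).
have mout A : measurable [set w | output run w = A] by exact: output_measurable.
have Eout A : Ex P (\1_[set w | output run w = A]) = Ex P (fun w => rnd (Z w) A).
  have [[h0 hC _] _] := hist_sigma run N.
  have hT : hist run N setT by rewrite -[setT]setD0; exact: hC.
  by have := output_law hT A; rewrite setTI Ex_indic// => ->.
have -> : Ex P (fun w => f (output run w)) = Ex P (fun w => \sum_A rnd (Z w) A * f A).
  rewrite Ex_sum => [|A _]; last exact: brf.
  transitivity (Ex P (fun w => \sum_A f A * \1_[set w | output run w = A] w)).
    congr Ex; apply/funext => w; rewrite (bigD1 (output run w))//= indicE mem_set// mulr1.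
    rewrite big1 ?addr0// => A; rewrite indicE => Aw; rewrite memNset ?mulr0//= => /esym/eqP.
    exact/negP.
  rewrite Ex_sum => [|A _]; last by apply: bddrvZ; exact: bddrv_indic.
  apply: eq_bigr => A _; rewrite ExZ; last exact: bddrv_indic.
  by rewrite Eout -ExZ//; congr Ex; apply/funext => w; rewrite mulrC.
apply: Ex_le; first exact: value_bddrv.
  by apply: bddrv_sum => A _; exact: brf.
apply: aeW => w; rewrite (_ : center N.+1 w = Z w); first exact: (rounding_lossless rl (ZK w)).
by apply/funext => k; rewrite /center addrC.
Qed.

End Run.

(** * The approximation guarantee *)

Theorem theorem11 (R : realType) :
  exists c : R, 0 < c /\
  forall (Omega : finType) (f : {set Omega} -> R) (M : R)
    (I : {set {set Omega}}) (rnd : (Omega -> R) -> {set Omega} -> R)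
    (disp : measure_display) (T : measurableType disp) (P : probability T R)
    (delta : R) (N b l : nat) (Xstar : {set Omega}),
  (forall A, 0 <= f A) -> monotone_set_fun f -> submodular f ->
  (forall A, `|f A| <= M) ->
  is_matroid I ->
  lossless_rounding f I rnd ->
  0 < delta -> (0 < N)%N -> (0 < b)%N -> (0 < l)%N ->
  transformed_set I delta !=set0 ->
  Xstar \in I -> (forall A, A \in I -> f A <= f Xstar) ->
  forall run : discrete_bbg P f I rnd delta N (fun=> b) (fun _ _ => l)
                 (fun t => 2 / ((t + 3)%:R `^ (2 / 3))),
  let d : R := #|Omega|%:R in
  let D1 : R := diam (transformed_set I delta) in
  let Q : R :=
    Num.max (2 * d ^+ 2 * M ^+ 2 * (1 / (l%:R * delta ^+ 2) + 8 * c) / b%:R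
               + 96 * d * (d - 1) * M ^+ 2 * D1 ^+ 2)
            (4 `^ (5 / 3) * d * M ^+ 2) in
  (((1 - 1 / expR 1) * f Xstar)%:E - 'E_P[fun w => f (output run w)] <=
   (3 * D1 * Num.sqrt Q / N%:R `^ (1 / 3)
    + 2 * M * Num.sqrt (d * (d - 1)) * D1 ^+ 2 / N%:R
    + 2 * M * delta * Num.sqrt d
        * (1 + (Num.sqrt d + 1) * (1 - 1 / expR 1)))%:E)%E.
Proof.
exists 1; split; first exact: ltr01.
move=> Omega f M I rnd disp T P delta N b l X f0 mf sf fM mI rl delta0 N0 b0 l0 K0 XI
  _ run; cbv zeta.
set d : R := #|Omega|%:R; set D1 : R := diam _; set Q : R := Num.max _ _.
have fb A : 0 <= f A <= M by rewrite f0/=; apply: le_trans (fM A); exact: ler_norm.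
have M0 := M_ge0 fb.
have O0 := dim_gt0 run; have d1 : 1 <= d by rewrite ler1n.
have d0 : 0 <= d by exact: ler0n.
have dm1 : 0 <= d - 1 by rewrite subr_ge0.
have K00 := transformed_set0 mI (ltW delta0) K0.
have D0 : 0 <= D1 by apply: le_trans (transformed_set_diam K00 K00); exact: sqrtr_ge0.
have bout : bddrv P (@measurable _ T) (fun w => f (output run w)).
  by apply: bddrv_discrete => A; exact: output_measurable.
have -> : ('E_P[fun w => f (output run w)] = (Ex P (fun w => f (output run w)))%:E)%E.
  rewrite unlock /Ex /Rintegral fineK//.
  by apply: integrable_fin_num => //; exact: bddrv_integrable.
rewrite -EFinB lee_fin.
have e1 : 1 <= expR 1 :> R by rewrite -[leLHS]expR0 ler_expR.
have q0 : 0 <= 1 - 1 / expR 1 :> R.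
  by rewrite subr_ge0 div1r invf_le1 ?expR_gt0.
have third : 2 * M * delta * d * (1 - 1 / expR 1) <= 2 * M * delta * Num.sqrt d
        * (1 + (Num.sqrt d + 1) * (1 - 1 / expR 1)).
  have sd0 : 0 <= Num.sqrt d by exact: sqrtr_ge0.
  have dE : d = Num.sqrt d * Num.sqrt d by rewrite -expr2 sqr_sqrtr// (le_trans ler01).
  rewrite [X in 2 * M * delta * X * _ <= _]dE.
  set q := 1 - 1 / _ in q0 *; set r := Num.sqrt d in sd0 *.
  rewrite -subr_ge0 (_ : _ - _ = 2 * M * delta * (r * (1 + q))); last by ring.
  apply: mulr_ge0; first by rewrite mulr_ge0 ?mulr_ge0// ltW.
  by apply: mulr_ge0 => //; apply: addr_ge0.
have Rge0 : 0 <= 3 * D1 * Num.sqrt Q / N%:R `^ (1 / 3)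
    + 2 * M * Num.sqrt (d * (d - 1)) * D1 ^+ 2 / N%:R.
  rewrite addr_ge0// divr_ge0 ?powR_ge0 ?ler0n// mulr_ge0 ?sqr_ge0 ?sqrtr_ge0//.
    by rewrite mulr_ge0.
  by rewrite mulr_ge0 ?sqrtr_ge0// mulr_ge0.
have third0 : 0 <= 2 * M * delta * d * (1 - 1 / expR 1).
  apply: mulr_ge0 => //; apply: mulr_ge0 => //; apply: mulr_ge0; last exact: ltW.
  exact: mulr_ge0.
have Eout0 : 0 <= Ex P (fun w => f (output run w)).
  by apply: Rintegral_ge0 => w _.
(* for [M = 0] the bound is trivial, and [Q] may vanish *)
move: M0; rewrite le_eqVlt => /orP[/eqP ME|M0].
  have fX : f X = 0.
    by have /andP[h1 h2] := fb X; apply/eqP; rewrite eq_le h1 andbT ME.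
  by rewrite fX mulr0; lra.
have Q0 : 0 < Q.
  rewrite lt_max; apply/orP; right.
  by rewrite mulr_gt0 ?exprn_gt0// mulr_gt0 ?powR_gt0// (lt_le_trans ltr01).
have [s [s01 sd Ks]] := scaled_indicator_transformed mI (ltW delta0) O0 K0 XI.
have hQ1 : 4 * (noise_level (Omega := Omega) l delta M / b%:R)
    + 16 * (d * (d - 1) * M ^+ 2 * D1 ^+ 2) <= Q.
  rewrite le_max; apply/orP; left; apply: lerD.
    rewrite mulrA; apply: ler_wpM2r; first by rewrite invr_ge0 ler0n.
    have dn : (delta != 0) && (l%:R != 0 :> R) by rewrite lt0r_neq0//= pnatr_eq0 -lt0n.
    rewrite /noise_level -/d.
    have -> : d ^+ 2 * M ^+ 2 / (2 * l%:R * delta ^+ 2)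
       = d ^+ 2 * M ^+ 2 * (1 / (l%:R * delta ^+ 2)) / 2.
      by field; have /andP[-> ->] := dn.
    set y := 1 / _; have y0 : 0 <= y.
      by rewrite divr_ge0// mulr_ge0 ?ler0n// sqr_ge0.
    have : 0 <= d ^+ 2 * M ^+ 2 by rewrite mulr_ge0 ?sqr_ge0.
    rewrite -[2 * d ^+ 2 * M ^+ 2]mulrA; set x := d ^+ 2 * M ^+ 2 => x0.
    lra.
  rewrite (_ : 96 * d * _ * _ * _ = 96 * (d * (d - 1) * M ^+ 2 * D1 ^+ 2)); last by ring.
  apply: ler_wpM2r; last by rewrite ler_nat.
  by apply: mulr_ge0; rewrite ?sqr_ge0//; apply: mulr_ge0; rewrite ?sqr_ge0//; apply: mulr_ge0.
have hQ2 : d * M ^+ 2 <= Q / 4%:R `^ (2 / 3).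
  rewrite ler_pdivlMr ?powR_gt0// le_max; apply/orP; right.
  rewrite -mulrA mulrC; apply: ler_wpM2r.
    by rewrite mulr_ge0 ?sqr_ge0.
  by apply: ler_powR; [rewrite ler1n|lra].
have main := expected_gap mf fb mI delta0 N0 K0 sf s01 Ks Q0
  (fun t tN => momentum_error mf fb mI delta0 N0 b0 l0 K0 run tN hQ1 hQ2).
have out := output_mean N0 run rl.
have C2 : M * Num.sqrt (d * (d - 1)) * D1 ^+ 2 / N%:R
   <= 2 * M * Num.sqrt (d * (d - 1)) * D1 ^+ 2 / N%:R.
  rewrite -!mulrA [leRHS]mulrC -[leLHS]mulr1; apply: ler_wpM2l; last by rewrite ler1n.
  by rewrite !mulr_ge0 ?sqrtr_ge0 ?sqr_ge0 ?invr_ge0 ?ler0n// ltW.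
have gapX : (1 - 1 / expR 1) * f X - (1 - 1 / expR 1) * (s * f X)
   <= 2 * M * delta * d * (1 - 1 / expR 1).
  rewrite -mulrBr [leRHS]mulrC; apply: ler_wpM2l => //.
  rewrite -[X in X - _]mul1r -mulrBl.
  have /andP[h1 h2] := fb X; have /andP[s0 s1] := s01.
  apply: (@le_trans _ _ ((1 - s) * M)); first by apply: ler_wpM2l => //; rewrite subr_ge0.
  have -> : 2 * M * delta * d = (2 * delta * d) * M by ring.
  by apply: ler_wpM2r; [exact: ltW|move: sd; rewrite -/d; lra].
move: main; rewrite -/d -/D1; lra.
Qed.
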